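(* Let $\mathcal X,\mathcal Y,\mathcal Z$ be finite sets, let $f\colon \mathcal X\times\mathcal Y\to\mathcal Z$, and let $\mu$ be a probability measure on $\mathcal X\times\mathcal Y$ with $\mathrm{IC}_\mu(f,0)>0$. Then there exist positive constants $\tau,\epsilon_0$ (depending on $f$ and $\mu$) such that for every $0\le \epsilon\le\epsilon_0$, \[ \mathrm{IC}_\mu(f,\epsilon)\le \mathrm{IC}_\mu(f,0)-\tau\, h(\epsilon). \] Moreover: (Non-constant case) If there are two points $a,b\in\mathrm{supp}\,\mu$ lying in the same row or in the same column (i.e. sharing their $\mathcal X$-coordinate or their $\mathcal Y$-coordinate) with $f(a)\ne f(b)$, then one can take $\tau\ge \mu(a)^2\mu(b)/64$, with $\epsilon_0$ depending only on $\min(\mu(a),\mu(b))$ and $|\mathcal X\times\mathcal Y|$. (AND case) If $x_0,x_1\in\mathcal X$, $y_0,y_1\in\mathcal Y$ satisfy $f(x_0,y_0)=f(x_0,y_1)=f(x_1,y_0)=z_0$ and $f(x_1,y_1)=z_1\ne z_0$, and $(x_0,y_0),(x_0,y_1),(x_1,y_0)\in\mathrm{supp}\,\mu$, then one can take $\tau\ge \frac{\mu(x_0,y_0)^2}{128}\min(\mu(x_0,y_1),\mu(x_1,y_0))$, with $\epsilon_0$ depending only on $|\mathcal X\times\mathcal Y|$ and on $\min\{\mu(x_0,y_0),\mu(x_0,y_1),\mu(x_1,y_0)\}$.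
   Context: Two-party randomized communication protocols: Alice receives $x\in\mathcal X$, Bob receives $y\in\mathcal Y$; they may use public and private randomness; the transcript $\Pi$ consists of the public random string and all exchanged bits; $\pi(x,y)$ denotes the output. For a distribution $\mu$ on $\mathcal X\times\mathcal Y$ and $(X,Y)\sim\mu$, the (internal) information cost of $\pi$ is $\mathrm{IC}_\mu(\pi)=I(\Pi;X\mid Y)+I(\Pi;Y\mid X)$. A protocol performs the task $[f,\epsilon]$ if $\Pr[\pi(x,y)\ne f(x,y)]\le\epsilon$ for every $(x,y)\in\mathcal X\times\mathcal Y$. $\mathrm{IC}_\mu(f,\epsilon)$ is the infimum of $\mathrm{IC}_\mu(\pi)$ over all protocols $\pi$ performing $[f,\epsilon]$. $h(x)=-x\log_2 x-(1-x)\log_2(1-x)$ is the binary entropy function. *)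

(* Defs.v *)
From HB Require Import structures.
From mathcomp Require Import all_boot all_order all_algebra.
From mathcomp Require Import all_classical all_reals all_analysis.

Set Implicit Arguments.
Unset Strict Implicit.
Unset Printing Implicit Defensive.

Import Order.TTheory GRing.Theory Num.Theory.
Local Open Scope ring_scope.

Record fdist (R : realType) (T : finType) := FDist {
  pmf :> T -> R;
  pmf_ge0 : forall t, 0 <= pmf t;
  pmf_sum1 : \sum_t pmf t = 1 }.

Lemma fprod_ge0 (R : realType) (A B : finType) (P : fdist R A) (Q : fdist R B)
  (w : A * B) : 0 <= P w.1 * Q w.2.
Proof. by rewrite mulr_ge0 ?pmf_ge0. Qed.

Lemma fprod_sum1 (R : realType) (A B : finType) (P : fdist R A) (Q : fdist R B) :
  \sum_(w : A * B) P w.1 * Q w.2 = 1.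
Proof.
rewrite -(pair_bigA _ (fun a b => P a * Q b)) /=.
under eq_bigr do rewrite -mulr_sumr pmf_sum1 mulr1.
exact: pmf_sum1.
Qed.

(* The law of a pair of independent elements with laws P and Q. *)
Definition fprod (R : realType) (A B : finType) (P : fdist R A) (Q : fdist R B) :
  fdist R (A * B)%type := FDist (fprod_ge0 P Q) (fprod_sum1 P Q).

Definition Pr (R : realType) (W : finType) (P : fdist R W) (E : pred W) : R :=
  \sum_(w | E w) P w.

Definition log2 (R : realType) (x : R) : R := ln x / ln 2.

(* Since [ln 0 = 0], the convention 0 log 0 = 0 holds at both endpoints. *)
Definition binary_entropy (R : realType) (x : R) : R :=
  - (x * log2 x) - (1 - x) * log2 (1 - x).

(* H(U | V) = E[- log2 p(U | V)] for random variables U, V on the finite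
   probability space (W, P); points of mass 0 contribute 0. *)
Definition cond_entropy (R : realType) (W : finType) (P : fdist R W)
    (TU TV : eqType) (U : W -> TU) (V : W -> TV) : R :=
  \sum_w P w *
    - log2 (Pr P [pred w' | (U w' == U w) && (V w' == V w)]
            / Pr P [pred w' | V w' == V w]).

(* I(U; V | S) = H(U | S) - H(U | V, S) *)
Definition cond_mutual_info (R : realType) (W : finType) (P : fdist R W)
    (TU TV TS : eqType) (U : W -> TU) (V : W -> TV) (S : W -> TS) : R :=
  cond_entropy P U S - cond_entropy P U (fun w => (V w, S w)).

(* Deterministic protocol trees: Alice owns an [AliceSends] node and sends a bit
   depending on her data in A, and symmetrically for Bob. The agreed output is
   the label of the leaf that is reached, hence a function of the bits sent. *)
Inductive ptree (A B Z : Type) : Type :=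
| Output of Z
| AliceSends of (A -> bool) & ptree A B Z & ptree A B Z
| BobSends of (B -> bool) & ptree A B Z & ptree A B Z.

Fixpoint tree_bits (A B Z : Type) (t : ptree A B Z) (a : A) (b : B) : seq bool :=
  match t with
  | Output _ => [::]
  | AliceSends s t0 t1 => s a :: tree_bits (if s a then t1 else t0) a b
  | BobSends s t0 t1 => s b :: tree_bits (if s b then t1 else t0) a b
  end.

Fixpoint tree_output (A B Z : Type) (t : ptree A B Z) (a : A) (b : B) : Z :=
  match t with
  | Output z => z
  | AliceSends s t0 t1 => tree_output (if s a then t1 else t0) a b
  | BobSends s t0 t1 => tree_output (if s b then t1 else t0) a b
  end.

(* A randomized protocol: independent public, Alice-private and Bob-private
   random strings, each ranging over an arbitrary finite set with an arbitrary
   distribution. Given the public string the parties follow a protocol tree in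
   which each of them sees their own input and their own private string. *)
Record protocol (R : realType) (X Y Z : finType) := Protocol {
  pub : finType;
  privA : finType;
  privB : finType;
  pub_law : fdist R pub;
  privA_law : fdist R privA;
  privB_law : fdist R privB;
  ptree_of : pub -> ptree (X * privA) (Y * privB) Z }.

Section Protocols.
Variables (R : realType) (X Y Z : finType).
Implicit Types (pi : protocol R X Y Z) (f : X * Y -> Z) (mu : fdist R (X * Y)%type).

Definition coins pi : finType := (pub pi * (privA pi * privB pi))%type.

Definition coins_law pi : fdist R (coins pi) :=
  fprod (pub_law pi) (fprod (privA_law pi) (privB_law pi)).

Definition transcript pi (i : X * Y) (c : coins pi) : pub pi * seq bool :=
  (c.1, tree_bits (ptree_of c.1) (i.1, c.2.1) (i.2, c.2.2)).

Definition output pi (i : X * Y) (c : coins pi) : Z :=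
  tree_output (ptree_of c.1) (i.1, c.2.1) (i.2, c.2.2).

(* pi performs the task [f, eps]: the error is bounded on every input, not only
   on average or on the support of some input distribution. *)
Definition performs pi f (eps : R) : Prop :=
  forall i : X * Y, Pr (coins_law pi) [pred c | output i c != f i] <= eps.

(* I(Pi; X | Y) + I(Pi; Y | X) for inputs drawn from mu, independently of the
   coins. *)
Definition info_cost mu pi : R :=
  let P := fprod mu (coins_law pi) in
  let Pi := fun w : (X * Y) * coins pi => transcript w.1 w.2 in
  let iX := fun w : (X * Y) * coins pi => w.1.1 in
  let iY := fun w : (X * Y) * coins pi => w.1.2 in
  cond_mutual_info P Pi iX iY + cond_mutual_info P Pi iY iX.

Definition IC mu f (eps : R) : R :=
  inf [set c : R | exists2 pi, performs pi f eps & c = info_cost mu pi]%classic.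

End Protocols.

(* Main.v *)
Require Import Defs.
From HB Require Import structures.
From mathcomp Require Import all_boot all_order all_algebra.
From mathcomp Require Import all_classical all_reals all_analysis.
From mathcomp Require Import lra.
Set Implicit Arguments.
Unset Strict Implicit.
Unset Printing Implicit Defensive.
Import Order.TTheory GRing.Theory Num.Theory.
Local Open Scope ring_scope.

(* Let a and b be adjacent inputs (they share a coordinate) of positive mass and
   let pi be a zero-error protocol. In the modified protocol the player who can
   tell b from a replaces the input b by a with probability e and then runs pi.
   This hides the replacement bit, so up to O(e) the information cost drops by the
   mixing entropy of that bit given the transcript; the drop is of order
   mu(b) * e * ln (1/e) as soon as, at a, some constant fraction c of the
   transcripts are at most e times as likely at b.

   If f(a) <> f(b), then c = 1. In the AND case, the rectangle property makes every
   transcript at (x0, y0) impossible at (x0, y1) or at (x1, y0), so that one of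
   the two pairs has c >= 1/2. In general, if f(i.1, j.2) differs from f(i) or
   f(j) for some i, j in one connected component of the support, then some step
   of a path from i to j has such a c, uniformly over near-optimal protocols; and
   if there are no such i, j, announcing the components of the rows and the
   columns gives a zero-error protocol of cost 0. *)

(** * The function [x ln x] and the entropy of splitting a mass in two *)

Section EntropyFunction.
Variable R : realType.
Implicit Types a b c d k m p q s u w x y : R.

Definition xlnx x : R := x * ln x.

(** In nats, [a + b] times the binary entropy of [a / (a + b)]: the uncertainty about which part a
    point of the total mass belongs to. *)
Definition mix_entropy a b : R := xlnx (a + b) - xlnx a - xlnx b.

Lemma xlnx0 : xlnx 0 = 0.
Proof. by rewrite /xlnx mul0r. Qed.

Lemma xlnx1 : xlnx 1 = 0.
Proof. by rewrite /xlnx ln1 mulr0. Qed.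

Lemma xlnxM a b : 0 <= a -> 0 <= b -> xlnx (a * b) = a * xlnx b + b * xlnx a.
Proof.
rewrite le_eqVlt => /predU1P[<-|a0]; first by rewrite !(mul0r, mulr0, xlnx0, addr0).
rewrite le_eqVlt => /predU1P[<-|b0]; first by rewrite !(mul0r, mulr0, xlnx0, addr0).
by rewrite /xlnx lnM ?posrE// ; lra.
Qed.

Lemma ln_le_subr1 x : 0 < x -> ln x <= x - 1.
Proof.
move=> x0; have := @le_ln1Dx R (x - 1); rewrite subrKC; apply.
by rewrite ltrBrDl subrr.
Qed.

Lemma xlnx_le0 x : x <= 1 -> xlnx x <= 0.
Proof.
move=> x1; have [x0|x0] := leP x 0; first by rewrite /xlnx ln0 ?mulr0.
by rewrite /xlnx mulr_ge0_le0 ?(ltW x0)// ln_le0.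
Qed.

(** Convexity: the left side is the tangent of [xlnx] at [b]. Many estimates below reduce to a
    tangent at a well-chosen point. *)
Lemma xlnx_ge a b : 0 <= a -> 0 < b -> a * ln b + a - b <= xlnx a.
Proof.
rewrite le_eqVlt => /predU1P[<-|a0] b0; first by rewrite xlnx0 mul0r; lra.
have := ln_le_subr1 (divr_gt0 b0 a0); rewrite ln_div ?posrE// => h.
have := ler_wpM2l (ltW a0) h.
have -> : a * (b / a - 1) = b - a by rewrite mulrBr mulr1 mulrCA divff ?mulr1 ?gt_eqF.
rewrite /xlnx; lra.
Qed.

Lemma xlnx_ge_subr1 x : 0 <= x -> x - 1 <= xlnx x.
Proof. by move=> x0; have := xlnx_ge x0 ltr01; rewrite ln1 mulr0 add0r. Qed.

Lemma mul_ln_le a b : 0 <= a -> a <= b -> xlnx a <= a * ln b.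
Proof.
rewrite le_eqVlt => /predU1P[<-|a0] ab; first by rewrite xlnx0 mul0r.
rewrite /xlnx ler_wpM2l// ?(ltW a0)// ler_ln ?posrE//; exact: lt_le_trans ab.
Qed.

Lemma mix_entropy_ge0 a b : 0 <= a -> 0 <= b -> 0 <= mix_entropy a b.
Proof.
move=> a0 b0; rewrite /mix_entropy {1}/xlnx mulrDl.
have := @mul_ln_le a (a + b) a0; rewrite lerDl => /(_ b0).
have := @mul_ln_le b (a + b) b0; rewrite lerDr => /(_ a0); lra.
Qed.

Lemma mix_entropy_scale w a b : 0 <= w -> 0 <= a -> 0 <= b ->
  mix_entropy (w * a) (w * b) = w * mix_entropy a b.
Proof.
move=> w0 a0 b0.
rewrite /mix_entropy -mulrDr !xlnxM ?addr_ge0//; lra.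
Qed.

Let tangent a s p q : 0 <= a -> a <= s -> 0 < p -> 0 < q ->
  a * (ln s + ln p - ln q) + a - s * p / q <= xlnx a.
Proof.
move=> a0 as_ p0 q0; have := le_trans a0 as_.
rewrite le_eqVlt => /predU1P[s0|s0].
  have -> : a = 0 by apply/eqP; rewrite eq_le a0 s0 as_.
  by rewrite -s0 !mul0r xlnx0; lra.
have := @xlnx_ge a (s * p / q) a0; rewrite divr_gt0 ?mulr_gt0// => /(_ isT).
by rewrite ln_div ?posrE ?mulr_gt0// lnM.
Qed.

(** The log sum inequality for two terms. The tangents are taken at the parts of [a + c]
    proportional to [s] and [u], so that their constant terms cancel. *)
Let log_sum a s c u : 0 <= a -> a <= s -> 0 <= c -> c <= u ->
  (a * ln s - xlnx a) + (c * ln u - xlnx c) <=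
  (a + c) * ln (s + u) - xlnx (a + c).
Proof.
move=> a0 as_ c0 cu; have [|ac] := leP (a + c) 0.
  move=> ac; have -> : a = 0 by lra. have -> : c = 0 by lra.
  by rewrite !addr0 !xlnx0 !mul0r; lra.
have su : 0 < s + u by lra.
have h1 := tangent a0 as_ ac su; have h2 := tangent c0 cu ac su.
have h3 : s * (a + c) / (s + u) + u * (a + c) / (s + u) = a + c.
  by rewrite -mulrDl -mulrDl mulrAC divff ?gt_eqF// mul1r.
rewrite [xlnx (a + c)]/xlnx; lra.
Qed.

(** Pooling two populations makes the split more uncertain: [log_sum] is applied to [a, c] and to
    [b, d], each against the totals [a + b] and [c + d]. *)
Lemma mix_entropy_superadd a b c d : 0 <= a -> 0 <= b -> 0 <= c -> 0 <= d ->
  mix_entropy a b + mix_entropy c d <= mix_entropy (a + c) (b + d).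
Proof.
move=> a0 b0 c0 d0; rewrite /mix_entropy (addrACA a c b d).
have h1 : a <= a + b by lra. have h2 : c <= c + d by lra.
have h3 : b <= a + b by lra. have h4 : d <= c + d by lra.
have := log_sum a0 h1 c0 h2; have := log_sum b0 h3 d0 h4.
rewrite [xlnx (a + b)]/xlnx [xlnx (c + d)]/xlnx [xlnx (a + b + _)]/xlnx; lra.
Qed.

Lemma mix_entropy_sum (I : finType) (w a b : I -> R) :
  (forall i, 0 <= w i) -> (forall i, 0 <= a i) -> (forall i, 0 <= b i) ->
  \sum_i w i * mix_entropy (a i) (b i) <=
  mix_entropy (\sum_i w i * a i) (\sum_i w i * b i).
Proof.
move=> w0 a0 b0; have -> : \sum_i w i * mix_entropy (a i) (b i) =
    \sum_i mix_entropy (w i * a i) (w i * b i).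
  by apply: eq_bigr => i _; rewrite mix_entropy_scale.
suff: [/\ 0 <= \sum_i w i * a i, 0 <= \sum_i w i * b i &
  \sum_i mix_entropy (w i * a i) (w i * b i) <=
  mix_entropy (\sum_i w i * a i) (\sum_i w i * b i)] by case.
elim/big_rec3: _ => [|i y s t _ [s0 t0 h]].
  by split=> //; rewrite /mix_entropy !addr0 xlnx0 subrr.
split; rewrite ?addr_ge0 ?mulr_ge0//.
apply: le_trans (mix_entropy_superadd _ _ _ _); rewrite ?mulr_ge0//.
by rewrite lerD2l.
Qed.

Lemma xlnx_superadd_sum (I : finType) (a : I -> R) :
  (forall i, 0 <= a i) -> \sum_i xlnx (a i) <= xlnx (\sum_i a i).
Proof.
move=> a0; suff: 0 <= \sum_i a i /\ \sum_i xlnx (a i) <= xlnx (\sum_i a i) by case.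
elim/big_rec2: _ => [|i y s _ [y0 h]]; first by rewrite xlnx0.
split; first by rewrite addr_ge0.
by have := mix_entropy_ge0 (a0 i) y0; rewrite /mix_entropy; lra.
Qed.

Lemma mix_entropy_le a b : 0 <= a -> 0 <= b -> mix_entropy a b <= a + b.
Proof.
move=> a0 b0; have [|ab] := leP (a + b) 0.
  move=> ab; have -> : a = 0 by lra. have -> : b = 0 by lra.
  by rewrite /mix_entropy !addr0 xlnx0; lra.
rewrite /mix_entropy.
have := xlnx_ge a0 ab; have := xlnx_ge b0 ab.
by rewrite [xlnx (a + b)]/xlnx; lra.
Qed.

(** Only the entropy term of [b], a fraction at most [1 / d] of [c], is kept. *)
Lemma mix_entropy_ge b c d : 0 <= b -> 0 < d -> b <= c -> d * b <= c ->
  b * ln d <= mix_entropy (c - b) b.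
Proof.
move=> b0 d0 bc dbc; rewrite /mix_entropy subrK.
have cb0 : 0 <= c - b by lra.
have h1 : c - b <= c by lra.
have := mul_ln_le cb0 h1.
move: b0; rewrite le_eqVlt => /predU1P[b0|b0].
  by rewrite -b0 subr0 xlnx0 mul0r; lra.
have : ln (d * b) <= ln c by rewrite ler_ln ?posrE ?mulr_gt0//; lra.
rewrite lnM ?posrE// => h; have := ler_wpM2l (ltW b0) h.
rewrite /xlnx; lra.
Qed.

(* Here [m] is the mass of a transcript, [w] that of the inputs being replaced
   with probability [e], and [k1], [k0] are the likelihoods of the transcript
   before and after the replacement. The mixture entropies split every mass
   according to the hidden replacement bit. *)
Lemma replacement_gain w k1 k0 m e : 0 <= w -> 0 <= k1 -> 0 <= k0 ->
  0 <= e -> e <= 1 -> w * k1 <= m ->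
  w * (xlnx ((1 - e) * k1 + e * k0) - xlnx k1)
   - xlnx (m - e * w * k1 + e * w * k0) + xlnx m <=
  - (e * k0 * xlnx w) + e * w * m
   - (mix_entropy (m - e * w * k1) (e * w * k0)
      - w * mix_entropy ((1 - e) * k1) (e * k0)).
Proof.
move=> w0 k10 k00 e0 e1 wkm; rewrite /mix_entropy.
have e10 : 0 <= 1 - e by lra.
have -> : xlnx (e * w * k0) = w * xlnx (e * k0) + e * k0 * xlnx w.
  by rewrite -xlnxM ?mulr_ge0//; congr xlnx; lra.
have ->: xlnx ((1 - e) * k1) = (1 - e) * xlnx k1 + k1 * xlnx (1 - e).
  by rewrite xlnxM.
have h1 : w * (k1 * xlnx (1 - e)) <= 0.
  by rewrite mulr_ge0_le0// mulr_ge0_le0// xlnx_le0//; lra.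
(* All terms in [k0] have cancelled. What remains follows from the tangents of [xlnx] at [m], taken
   at the points [m - e * w * k1] and [k1]. *)
suff : xlnx m - xlnx (m - e * w * k1) <= e * w * (m + xlnx k1) by lra.
have wk0 : 0 <= w * k1 by rewrite mulr_ge0.
have ewk0 : 0 <= e * w * k1 by rewrite !mulr_ge0.
have ewk1 : e * w * k1 <= w * k1 by rewrite -mulrA ler_piMl.
have := le_trans wk0 wkm; rewrite le_eqVlt => /predU1P[m0|m0].
  have z : e * w * k1 = 0 by lra.
  rewrite -m0 z subr0 subrr add0r /xlnx mulrA z mul0r//.
have mA : 0 <= m - e * w * k1 by lra.
have h2 := xlnx_ge mA m0; have h3 := xlnx_ge k10 m0.
have := ler_wpM2l (mulr_ge0 e0 w0) h3.
by rewrite [xlnx m]/xlnx; lra.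
Qed.

(** Given the input, the bit is nearly determined: its entropy is at most [(1 - e) * k1 + e * k0],
    hence at most [2 * e * k0]. Among all inputs, the replaced mass is at most a fraction
    [e * w / w0] of the total, which yields the factor [- ln e]. *)
Lemma replacement_gain_ge w w0 k1 k0 m e : 0 < w -> w <= 1 -> 0 < w0 ->
  0 <= k1 -> 0 <= k0 -> 0 < e -> e <= 1 -> w * k1 <= m -> k1 <= e * k0 ->
  w0 * k0 <= m - e * w * k1 + e * w * k0 ->
  e * w * k0 * (- ln e + ln w0 - 2) <=
  mix_entropy (m - e * w * k1) (e * w * k0)
      - w * mix_entropy ((1 - e) * k1) (e * k0).
Proof.
move=> w_gt0 w1 w0_gt0 k10 k00 e0 e1 wkm k1k0 wk0.
have e10 : 0 <= 1 - e by lra.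
have ek1 : (1 - e) * k1 <= k1 by rewrite ler_piMl//; lra.
have h := mix_entropy_le (mulr_ge0 e10 k10) (mulr_ge0 (ltW e0) k00).
have h' : mix_entropy ((1 - e) * k1) (e * k0) <= 2 * (e * k0) by lra.
have := ler_wpM2l (ltW w_gt0) h'.
have ewk1 : e * (w * k1) <= w * k1.
  by rewrite ler_piMl// mulr_ge0// ltW.
have b0 : 0 <= e * w * k0 by rewrite mulr_ge0// mulr_ge0// ltW.
have := @mix_entropy_ge (e * w * k0) (m - e * w * k1 + e * w * k0) (w0 / (e * w)).
rewrite b0 divr_gt0 ?mulr_gt0// => /(_ isT isT).
have -> : w0 / (e * w) * (e * w * k0) = w0 * k0.
  by rewrite mulrA mulfVK// gt_eqF// mulr_gt0.
have h0 : e * w * k0 <= m - e * w * k1 + e * w * k0 by lra.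
move=> /(_ h0 wk0); rewrite addrK ln_div ?posrE ?mulr_gt0// lnM ?posrE//.
have := ln_le0 w1 => lw.
have := mulr_ge0_le0 b0 lw; lra.
Qed.

End EntropyFunction.

(** * Information carried by a channel *)

Section ChannelInformation.
Variables (R : realType) (I : finType) (T : Type).
Implicit Types (w : I -> R) (k : I -> T -> R) (D : seq T) (P : pred T) (e c : R).

(* [ln 2] times the mutual information between an input of law w and its image
   under the channel k, when w has mass 1; for a sub-probability w of mass W, it
   is [W * ln 2] times the mutual information under the normalized law [w / W]. *)
Definition chan_info D w k : R :=
  \sum_(t <- D) (\sum_i w i * xlnx (k i t) - xlnx (\sum_i w i * k i t))
  + xlnx (\sum_i w i).

Lemma sum_update (F G : I -> R) i1 : (forall i, i != i1 -> F i = G i) ->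
  \sum_i F i = \sum_i G i + (F i1 - G i1).
Proof.
move=> FG; rewrite (bigD1 i1)//= [in RHS](bigD1 i1)//= (eq_bigr G)//.
lra.
Qed.

(** Data processing: merging two outputs cannot increase the information, by concavity of the
    mixture entropy. *)
Lemma chan_info_subadd w (a b : I -> R) : (forall i, 0 <= w i) ->
  (forall i, 0 <= a i) -> (forall i, 0 <= b i) ->
  \sum_i w i * xlnx (a i + b i) - xlnx (\sum_i w i * (a i + b i)) <=
  (\sum_i w i * xlnx (a i) - xlnx (\sum_i w i * a i)) +
  (\sum_i w i * xlnx (b i) - xlnx (\sum_i w i * b i)).
Proof.
move=> w0 a0 b0; have := mix_entropy_sum w0 a0 b0; rewrite /mix_entropy.
have -> : \sum_i w i * (a i + b i) = \sum_i w i * a i + \sum_i w i * b i.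
  by rewrite -big_split; apply: eq_bigr => i _; rewrite mulrDr.
have -> : \sum_i w i * (xlnx (a i + b i) - xlnx (a i) - xlnx (b i)) =
   \sum_i w i * xlnx (a i + b i) - \sum_i w i * xlnx (a i) - \sum_i w i * xlnx (b i).
  by rewrite -!sumrB; apply: eq_bigr => i _; rewrite !mulrBr.
lra.
Qed.

(** Merging the outputs one after another leaves a single output, which carries no information. *)
Lemma chan_info_ge0 D w k : (forall i, 0 <= w i) -> (forall i t, 0 <= k i t) ->
  (forall i, \sum_(t <- D) k i t = 1) -> 0 <= chan_info D w k.
Proof.
move=> w0 k0 k1; suff : \sum_i w i * xlnx (\sum_(t <- D) k i t) -
    xlnx (\sum_i w i * \sum_(t <- D) k i t) <=
    \sum_(t <- D) (\sum_i w i * xlnx (k i t) - xlnx (\sum_i w i * k i t)).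
  under eq_bigr do rewrite k1 xlnx1 mulr0.
  under [in xlnx _]eq_bigr do rewrite k1 mulr1.
  by rewrite big1// /chan_info; lra.
elim: D {k1} => [|t D IH].
  rewrite big_nil big1 => [|i _]; last by rewrite big_nil xlnx0 mulr0.
  by rewrite big1 ?xlnx0 ?subrr// => i _; rewrite big_nil mulr0.
rewrite big_cons; apply: le_trans (lerD (lexx _) IH).
under eq_bigr do rewrite big_cons.
under [X in _ - xlnx X]eq_bigr do rewrite big_cons.
by apply: chan_info_subadd => // i; rewrite sumr_ge0.
Qed.

(** The information is at most the entropy of the input, each term of which is at most 1. *)
Lemma chan_info_le_card D w k : (forall i, 0 <= w i) -> \sum_i w i <= 1 ->
  (forall i t, 0 <= k i t) -> (forall i, \sum_(t <- D) k i t = 1) ->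
  chan_info D w k <= #|I|%:R.
Proof.
move=> w0 w1 k0 k1; rewrite /chan_info.
have := xlnx_le0 w1; suff : \sum_(t <- D)
    (\sum_i w i * xlnx (k i t) - xlnx (\sum_i w i * k i t)) <= #|I|%:R by lra.
apply: (@le_trans _ _ (\sum_(t <- D) \sum_i - (k i t * xlnx (w i)))).
  apply: ler_sum => t _.
  have := xlnx_superadd_sum (fun i => mulr_ge0 (w0 i) (k0 i t)).
  have -> : \sum_i xlnx (w i * k i t) =
      \sum_i w i * xlnx (k i t) - \sum_i - (k i t * xlnx (w i)).
    by rewrite -sumrB; apply: eq_bigr => i _; rewrite xlnxM//; lra.
  lra.
rewrite exchange_big /= -sum1_card natr_sum ler_sum// => i _.
rewrite sumrN -mulr_suml k1.
have := xlnx_ge_subr1 (w0 i); have := w0 i; lra.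
Qed.

(** The mixture arises from the scaled channels [(1 - e) * k] and [e * k'] by merging the two copies
    of each output. *)
Lemma chan_info_convex D w k k' e : (forall i, 0 <= w i) ->
  (forall i t, 0 <= k i t) -> (forall i t, 0 <= k' i t) -> 0 <= e -> e <= 1 ->
  chan_info D w (fun i t => (1 - e) * k i t + e * k' i t) <=
  (1 - e) * chan_info D w k + e * chan_info D w k'.
Proof.
move=> w0 k0 k'0 e0 e1; have e'0 : 0 <= 1 - e by lra.
rewrite /chan_info !mulrDr !mulr_sumr.
set W := xlnx _; suff : \sum_(t <- D) (\sum_i w i * xlnx ((1 - e) * k i t + e * k' i t) -
   xlnx (\sum_i w i * ((1 - e) * k i t + e * k' i t))) <=
   \sum_(t <- D) ((1 - e) * (\sum_i w i * xlnx (k i t) - xlnx (\sum_i w i * k i t))) +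
   \sum_(t <- D) (e * (\sum_i w i * xlnx (k' i t) - xlnx (\sum_i w i * k' i t))) by lra.
rewrite -big_split ler_sum// => t _ /=.
have scal (s : R) (q : I -> R) : 0 <= s -> (forall i, 0 <= q i) ->
    s * (\sum_i w i * xlnx (q i) - xlnx (\sum_i w i * q i)) =
    \sum_i w i * xlnx (s * q i) - xlnx (\sum_i w i * (s * q i)).
  move=> s0 q0; under [X in _ = X - _]eq_bigr do rewrite xlnxM// mulrDr mulrCA (mulrA _ _ (xlnx s)).
  rewrite big_split /= -mulr_sumr -mulr_suml.
  under [X in _ - xlnx X]eq_bigr do rewrite mulrCA.
  rewrite -mulr_sumr xlnxM// ?sumr_ge0// => [|i _]; last by rewrite mulr_ge0.
  lra.
rewrite !scal//.
by apply: chan_info_subadd => // i; rewrite mulr_ge0.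
Qed.

Lemma chan_info_eq0 D w k : (forall i, 0 <= w i) -> (forall i t, 0 <= k i t) ->
  (forall i, \sum_(t <- D) k i t = 1) ->
  (forall i j t, 0 < w i -> 0 < w j -> k i t = k j t) -> chan_info D w k = 0.
Proof.
move=> w0 k0 k1 kk; rewrite /chan_info.
have [/existsP[i wi]|/existsPn nw] := boolP [exists i, 0 < w i]; last first.
  have wz i : w i = 0 by apply/eqP; rewrite eq_le w0 leNgt nw.
  rewrite [\sum_i w i]big1// xlnx0 addr0 big1// => t _.
  by rewrite !big1 ?xlnx0 ?subrr// => i _; rewrite wz mul0r.
have wk (g : R -> R) t : \sum_j w j * g (k j t) = (\sum_j w j) * g (k i t).
  rewrite mulr_suml; apply: eq_bigr => j _.
  have := w0 j; rewrite le_eqVlt => /predU1P[<-|wj]; first by rewrite !mul0r.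
  by rewrite (kk j i).
under eq_bigr do rewrite wk (wk id) xlnxM ?sumr_ge0// opprD addrA subrr add0r.
by rewrite sumrN -mulr_suml k1 mul1r addNr.
Qed.

(** * Replacing one input of a channel by another with small probability *)

Section Replacement.
Variables (D : seq T) (w : I -> R) (k : I -> T -> R) (e : R) (x0 x1 : I).
Hypothesis w_ge0 : forall i, 0 <= w i.
Hypothesis w_le1 : \sum_i w i <= 1.
Hypothesis k_ge0 : forall i t, 0 <= k i t.
Hypothesis k_sum1 : forall i, \sum_(t <- D) k i t = 1.
Hypotheses (e_ge0 : 0 <= e) (e_le1 : e <= 1).

Definition replace_chan i t := (1 - e) * k i t + e * k (if i == x1 then x0 else i) t.

Let m t := \sum_i w i * k i t.

(** At output [t], the entropy of the replacement bit given the output alone, minus its entropy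
    given also the original input. Inputs other than [x1] are never replaced and have no second
    term. *)
Definition replacement_mixing t : R :=
  mix_entropy (m t - e * w x1 * k x1 t) (e * w x1 * k x0 t)
  - w x1 * mix_entropy ((1 - e) * k x1 t) (e * k x0 t).

Let replace_other i t : i != x1 -> replace_chan i t = k i t.
Proof. by rewrite /replace_chan => /negbTE -> /=; lra. Qed.

Let replace_mass t :
  \sum_i w i * replace_chan i t = m t - e * w x1 * k x1 t + e * w x1 * k x0 t.
Proof.
rewrite (@sum_update _ (fun i => w i * k i t) x1) => [|i ix1]; last by rewrite replace_other.
rewrite /replace_chan eqxx -/(m t); lra.
Qed.

Let mass_ge i t : w i * k i t <= m t.
Proof. by rewrite /m (bigD1 i)//= lerDl sumr_ge0// => j _; rewrite mulr_ge0. Qed.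

(** The mass of the other inputs joins the unreplaced part; being unsplit, it has mixture entropy 0,
    and superadditivity applies. *)
Lemma replacement_mixing_ge0 t : 0 <= replacement_mixing t.
Proof.
have e'0 : 0 <= 1 - e by rewrite subr_ge0.
rewrite /replacement_mixing -mix_entropy_scale ?mulr_ge0// subr_ge0.
have := @mix_entropy_superadd _ (w x1 * ((1 - e) * k x1 t)) (w x1 * (e * k x0 t))
  (m t - w x1 * k x1 t) 0.
rewrite !mulr_ge0// subr_ge0 mass_ge => /(_ isT isT isT (lexx _)).
rewrite [mix_entropy (m t - _) 0]/mix_entropy addr0 xlnx0 subrr subr0 !addr0.
by move/le_trans; apply; rewrite le_eqVlt; apply/orP; left; apply/eqP;
  congr mix_entropy; lra.
Qed.

Lemma chan_info_replace_mixing :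
  chan_info D w replace_chan <=
  chan_info D w k + e - \sum_(t <- D) replacement_mixing t.
Proof.
rewrite /chan_info.
have w1x : w x1 <= 1.
  by apply: le_trans w_le1; rewrite (bigD1 x1)//= lerDl sumr_ge0.
suff : \sum_(t <- D) (\sum_i w i * xlnx (replace_chan i t)
      - xlnx (\sum_i w i * replace_chan i t)) <=
    \sum_(t <- D) (\sum_i w i * xlnx (k i t) - xlnx (m t)) + 
    \sum_(t <- D) (- (e * k x0 t * xlnx (w x1)) + e * w x1 * m t) -
    \sum_(t <- D) replacement_mixing t.
  (* The linear error terms of [replacement_gain] sum to at most [e * (1 - w x1) + e * w x1 = e]. *)
  have -> : \sum_(t <- D) (- (e * k x0 t * xlnx (w x1)) + e * w x1 * m t) =
      - (e * xlnx (w x1)) + e * w x1 * \sum_i w i.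
    rewrite big_split /= sumrN -mulr_suml -mulr_sumr k_sum1 mulr1; congr (_ + _).
    rewrite -mulr_sumr exchange_big /=; congr (_ * _); apply: eq_bigr => i _.
    by rewrite -mulr_sumr k_sum1 mulr1.
  have h1 := ler_wpM2l (mulr_ge0 e_ge0 (w_ge0 x1)) w_le1.
  have h2 := ler_wpM2l e_ge0 (xlnx_ge_subr1 (w_ge0 x1)).
  rewrite -/(m _); lra.
rewrite -sumrN -!big_split ler_sum// => t _ /=.
rewrite replace_mass (@sum_update _ (fun i => w i * xlnx (k i t)) x1)
  => [|i ix1]; last by rewrite replace_other.
have := @replacement_gain R (w x1) (k x1 t) (k x0 t) (m t) e.
rewrite /replacement_mixing /replace_chan eqxx => /(_ _ _ _ _ _ (mass_ge _ _)).
by move=> /(_ (w_ge0 _) (k_ge0 _ _) (k_ge0 _ _) e_ge0 e_le1); lra.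
Qed.

Lemma chan_info_replace_le :
  chan_info D w replace_chan <= chan_info D w k + e.
Proof.
apply: le_trans chan_info_replace_mixing _; rewrite lerBlDr lerDl sumr_ge0// => t _.
exact: replacement_mixing_ge0.
Qed.

(** Outputs in [P] contribute through [replacement_gain_ge], the others nonnegatively. The last term
    collects the loss [e] of [chan_info_replace_mixing] and the loss [2 - ln (w x0)] per replaced
    mass. *)
Lemma chan_info_replace_lt c P : 0 < e -> 0 < w x0 -> 0 < w x1 ->
  (forall t, P t -> k x1 t <= e * k x0 t) -> c <= \sum_(t <- D | P t) k x0 t ->
  chan_info D w replace_chan <=
  chan_info D w k - c * w x1 * (e * - ln e) + (3 - ln (w x0)) * e.
Proof.
move=> e0 w0 w1 kP kc; apply: le_trans chan_info_replace_mixing _.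
have wle i : w i <= 1.
  by apply: le_trans w_le1; rewrite (bigD1 i)//= lerDl sumr_ge0.
have lw0 := ln_le0 (wle x0); have le := ln_le0 e_le1.
suff : e * w x1 * (c * - ln e + ln (w x0) - 2) <= \sum_(t <- D) replacement_mixing t.
  have := ler_wpM2l e_ge0 (wle x1).
  have : 0 <= e * (1 - w x1) * (2 - ln (w x0)).
    by rewrite mulr_ge0// ?mulr_ge0//; [have := wle x1|]; lra.
  lra.
apply: (@le_trans _ _ (\sum_(t <- D | P t) e * w x1 * k x0 t * (- ln e + ln (w x0) - 2))).
  rewrite -mulr_suml -mulr_sumr -[leRHS]mulrA ler_wpM2l ?mulr_ge0//.
  set q := \sum_(_ <- _ | _) _ in kc *.
  have q1 : q <= 1.
    by rewrite -(k_sum1 x0) /q [X in X <= _]big_mkcond ler_sum// => t _; case: ifP.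
  have := ler_wpM2r (_ : 0 <= - ln e) kc; rewrite oppr_ge0 => /(_ le).
  have := ler_wpM2r (_ : 0 <= 2 - ln (w x0)) q1.
  have -> : 0 <= 2 - ln (w x0) by lra.
  move=> /(_ isT); lra.
rewrite big_mkcond ler_sum// => t _; case: ifPn => [Pt|_].
  apply: replacement_gain_ge => //; first exact: kP.
  rewrite -replace_mass.
  apply: (@le_trans _ _ (w x0 * replace_chan x0 t)).
    rewrite ler_wpM2l// /replace_chan; case: eqP => [->|_] /=; lra.
  rewrite (bigD1 x0)//= lerDl sumr_ge0// => j _; rewrite mulr_ge0// addr_ge0//.
    by rewrite mulr_ge0// subr_ge0.
  by rewrite mulr_ge0.
exact: replacement_mixing_ge0.
Qed.

End Replacement.

End ChannelInformation.

(** * Conditional mutual information as a sum of channel informations *)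

Section FiniteProbability.
Variable R : realType.

Lemma expect_image (W : finType) (P : W -> R) (T : eqType) (h : W -> T)
    (D : seq T) (F : T -> R) : uniq D -> (forall w, h w \in D) ->
  \sum_w P w * F (h w) = \sum_(t <- D) (\sum_(w | h w == t) P w) * F t.
Proof.
move=> uD hD; under [RHS]eq_bigr do rewrite mulr_suml big_mkcond.
rewrite exchange_big /=; apply: eq_bigr => w _.
rewrite -big_mkcond -big_filter (eq_filter (a2 := pred1 (h w))).
  by rewrite filter_pred1_uniq// big_seq1.
by move=> t; rewrite /= eq_sym.
Qed.

Lemma Pr_ge0 (W : finType) (P : fdist R W) (E : pred W) : 0 <= Pr P E.
Proof. by rewrite /Pr sumr_ge0// => w _; exact: Defs.pmf_ge0. Qed.

Lemma Pr_ge_pmf (W : finType) (P : fdist R W) (E : pred W) w : E w -> P w <= Pr P E.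
Proof.
by move=> Ew; rewrite /Pr (bigD1 w)//= lerDl sumr_ge0// => v _; exact: Defs.pmf_ge0.
Qed.

Lemma Pr_le1 (W : finType) (P : fdist R W) (E : pred W) : Pr P E <= 1.
Proof.
rewrite -(pmf_sum1 P) /Pr big_mkcond ler_sum// => w _.
by case: ifP => // _; exact: Defs.pmf_ge0.
Qed.

Lemma pmf_le1 (W : finType) (P : fdist R W) w : P w <= 1.
Proof. by apply: le_trans (Pr_ge_pmf P (_ : predT w)) (Pr_le1 P _). Qed.

Lemma Pr_fprod (J C : finType) (mu : fdist R J) (Q : fdist R C) (E : pred (J * C)) :
  Pr (Defs.fprod mu Q) E = \sum_j mu j * Pr Q [pred c | E (j, c)].
Proof.
rewrite /Pr big_mkcond.
rewrite (eq_bigr (fun p => if E (p.1, p.2) then mu p.1 * Q p.2 else 0)) => [|[]//].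
rewrite -(pair_bigA _ (fun j c => if E (j, c) then mu j * Q c else 0)) /=.
by apply: eq_bigr => j _; rewrite mulr_sumr [RHS]big_mkcond.
Qed.

Lemma law_sum1 (C : finType) (Q : fdist R C) (T : eqType) (h : C -> T) (D : seq T) :
  uniq D -> (forall c, h c \in D) -> \sum_(t <- D) Pr Q [pred c | h c == t] = 1.
Proof.
move=> uD hD; rewrite -(pmf_sum1 Q).
have := @expect_image _ Q _ h D (fun=> 1) uD hD.
by under eq_bigr do rewrite mulr1; under [in RHS]eq_bigr do rewrite mulr1.
Qed.

Section ConditionalInformation.
Variables (J C : finType) (mu : fdist R J) (Q : fdist R C).
Variables (TU TV : eqType) (TS : finType).
Variables (U : J -> C -> TU) (V : J -> TV) (S : J -> TS) (D : seq TU).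
Hypotheses (uD : uniq D) (UD : forall j c, U j c \in D).
Hypothesis VS_inj : forall i j, V i = V j -> S i = S j -> i = j.

Let law j t := Pr Q [pred c | U j c == t].

(** Since [V] and [S] together determine the input, conditioning on both leaves only the randomness
    of the coins. Finite sums over the values of [U] run over the list [D], as [TU] may be
    infinite. *)
Lemma cond_mutual_infoE :
  ln 2 * cond_mutual_info (Defs.fprod mu Q) (fun w => U w.1 w.2)
    (fun w => V w.1) (fun w => S w.1) =
  \sum_s (\sum_(t <- D) (\sum_(j | S j == s) mu j * xlnx (law j t)
                         - xlnx (\sum_(j | S j == s) mu j * law j t))
          + xlnx (\sum_(j | S j == s) mu j)).
Proof.
pose mS s := \sum_(j | S j == s) mu j.
pose mUS t s := \sum_(j | S j == s) mu j * law j t.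
have PrS s : Pr (Defs.fprod mu Q) [pred w | S w.1 == s] = mS s.
  rewrite Pr_fprod /mS [RHS]big_mkcond; apply: eq_bigr => j _ /=.
  case: eqP => _; last by rewrite /Pr big_pred0 ?mulr0.
  by rewrite /Pr (eq_bigl predT)// pmf_sum1 mulr1.
have PrUS t s : Pr (Defs.fprod mu Q) [pred w | (U w.1 w.2 == t) && (S w.1 == s)] = mUS t s.
  rewrite Pr_fprod /mUS [RHS]big_mkcond; apply: eq_bigr => j _ /=.
  case: eqP => _; last by rewrite /Pr big_pred0 ?mulr0// => c /=; rewrite andbF.
  by congr (_ * _); apply: eq_bigl => c /=; rewrite andbT.
have VSE i j : ((V i, S i) == (V j, S j)) = (i == j).
  apply/eqP/eqP => [[]|->//]; exact: VS_inj.
have PrVS j : Pr (Defs.fprod mu Q) [pred w | (V w.1, S w.1) == (V j, S j)] = mu j.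
  rewrite Pr_fprod (bigD1 j)//= [X in _ + X]big1 => [|i ij].
    by rewrite addr0 /Pr (eq_bigl predT) ?pmf_sum1 ?mulr1// => c /=; rewrite VSE eqxx.
  by rewrite /Pr big_pred0 ?mulr0// => c /=; rewrite VSE (negbTE ij).
have PrUVS t j : Pr (Defs.fprod mu Q) [pred w | (U w.1 w.2 == t) &&
    ((V w.1, S w.1) == (V j, S j))] = mu j * law j t.
  rewrite Pr_fprod (bigD1 j)//= [X in _ + X]big1 => [|i ij].
    rewrite addr0; congr (_ * _); apply: eq_bigl => c /=.
    by rewrite VSE eqxx andbT.
  by rewrite /Pr big_pred0 ?mulr0// => c /=; rewrite VSE (negbTE ij) andbF.
have law_ge0 j t : 0 <= law j t by exact: Pr_ge0.
have ln2 : ln 2 != 0 :> R by rewrite gt_eqF// ln_gt0// ltr1n.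
(* The pointwise information density; the mutual information is its mean. Logarithms of quotients
   are split only at points of positive mass. *)
pose G j t := ln (mS (S j)) - ln (mUS t (S j)) + ln (law j t).
have -> : ln 2 * cond_mutual_info (Defs.fprod mu Q) (fun w => U w.1 w.2)
    (fun w => V w.1) (fun w => S w.1) =
    \sum_(w : J * C) mu w.1 * Q w.2 * G w.1 (U w.1 w.2).
  rewrite /cond_mutual_info /cond_entropy -sumrB mulr_sumr.
  apply: eq_bigr => -[j c] _ /=.
  rewrite PrS PrUS PrVS PrUVS -mulrBr mulrCA.
  have := Defs.pmf_ge0 mu j; rewrite le_eqVlt => /predU1P[<-|muj]; first by rewrite !mul0r.
  have := Defs.pmf_ge0 Q c; rewrite le_eqVlt => /predU1P[<-|Qc]; first by rewrite !(mulr0, mul0r).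
  congr (_ * _).
  have lawj : 0 < law j (U j c).
    by apply: lt_le_trans Qc (Pr_ge_pmf _ _); rewrite /= eqxx.
  have mSj : 0 < mS (S j).
    apply: lt_le_trans muj _; rewrite /mS (bigD1 j)//= lerDl sumr_ge0// => *.
    exact: Defs.pmf_ge0.
  have mUSj : 0 < mUS (U j c) (S j).
    apply: lt_le_trans (mulr_gt0 muj lawj) _; rewrite /mUS (bigD1 j)//= lerDl.
    by rewrite sumr_ge0// => i _; rewrite mulr_ge0// Defs.pmf_ge0.
  rewrite /log2 !ln_div ?posrE// ?mulr_gt0// lnM ?posrE// /G.
  have simp (p q : R) : ln 2 * (- (p / ln 2) - - (q / ln 2)) = q - p.
    by rewrite opprK -mulNr -mulrDl mulrCA divff// mulr1 addrC.
  rewrite simp; lra.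
rewrite -(pair_bigA _ (fun j c => mu j * Q c * G j (U j c))) /=.
rewrite (partition_big S predT)//=; apply: eq_bigr => s _.
transitivity (\sum_(j | S j == s) mu j * \sum_(t <- D) law j t *
    (ln (mS s) - ln (mUS t s) + ln (law j t))).
  apply: eq_bigr => j /eqP Sj.
  under eq_bigr do rewrite -mulrA.
  rewrite -mulr_sumr; congr (_ * _).
  by rewrite (@expect_image _ Q _ (U j) D (G j)) // /G Sj.
have -> : xlnx (\sum_(j | S j == s) mu j) =
    \sum_(j | S j == s) mu j * \sum_(t <- D) law j t * ln (mS s).
  rewrite {1}/xlnx mulr_suml; apply: eq_bigr => j _.
  by rewrite -mulr_suml law_sum1// mul1r.
rewrite sumrB exchange_big /=.
have -> : \sum_(t <- D) xlnx (\sum_(j | S j == s) mu j * law j t) =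
    \sum_(j | S j == s) mu j * \sum_(t <- D) law j t * ln (mUS t s).
  under [RHS]eq_bigr do rewrite mulr_sumr.
  rewrite exchange_big; apply: eq_bigr => t _ /=.
  by rewrite {1}/xlnx mulr_suml; apply: eq_bigr => j _; rewrite mulrA.
rewrite -sumrB -big_split; apply: eq_bigr => j _ /=.
rewrite -mulr_sumr -mulrBr -mulrDr; congr (_ * _).
by rewrite -sumrB -big_split; apply: eq_bigr => t _ /=; rewrite /xlnx; lra.
Qed.

End ConditionalInformation.
End FiniteProbability.

(** * Laws of transcripts and the rectangle property *)

Section Transcripts.
Variables (R : realType) (X Y Z : finType).
Implicit Types (pi : protocol R X Y Z) (f : X * Y -> Z) (mu : fdist R (X * Y)%type).

Definition transcript_law pi (i : X * Y) (t : pub pi * seq bool) : R :=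
  Pr (coins_law pi) [pred c | transcript i c == t].

Definition transcripts pi : seq (pub pi * seq bool) :=
  undup [seq transcript p.1 p.2 | p <- enum {: (X * Y) * coins pi}].

Lemma transcripts_uniq pi : uniq (transcripts pi).
Proof. exact: undup_uniq. Qed.

Lemma mem_transcripts pi (i : X * Y) (c : coins pi) : transcript i c \in transcripts pi.
Proof. by rewrite mem_undup; apply/mapP; exists (i, c); rewrite ?mem_enum. Qed.

Lemma transcript_law_ge0 pi i t : 0 <= @transcript_law pi i t.
Proof. exact: Pr_ge0. Qed.

Lemma transcript_law_sum1 pi i : \sum_(t <- transcripts pi) transcript_law i t = 1.
Proof. by apply: law_sum1 (transcripts_uniq pi) _ => c; exact: mem_transcripts. Qed.

(** The list [D] is left free so that a protocol and its modification can be compared term by term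
    over the same transcripts. *)
Lemma info_costE mu pi (D : seq (pub pi * seq bool)) : uniq D ->
    (forall (i : X * Y) (c : coins pi), transcript i c \in D) ->
  ln 2 * info_cost mu pi =
  \sum_y chan_info D (fun x => mu (x, y)) (fun x => @transcript_law pi (x, y)) +
  \sum_x chan_info D (fun y => mu (x, y)) (fun y => @transcript_law pi (x, y)).
Proof.
move=> uD inD; rewrite /info_cost mulrDr; congr (_ + _).
  rewrite (@cond_mutual_infoE _ _ _ mu (coins_law pi) _ _ _
    (@transcript _ _ _ _ pi) (fun i => i.1) (fun i => i.2) D)//; last first.
    by move=> [? ?] [? ?] /= -> ->.
  have sumE y (F : X * Y -> R) : \sum_(j | j.2 == y) F j = \sum_x F (x, y).
    rewrite (reindex (fun x => (x, y))) /=; last first.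
      by exists (fun i => i.1) => // -[? ?]; rewrite inE /= => /eqP->.
    by apply: eq_bigl => x; rewrite eqxx.
  apply: eq_bigr => y _; rewrite /chan_info sumE; congr (_ + _).
  by apply: eq_bigr => t _; rewrite !sumE.
rewrite (@cond_mutual_infoE _ _ _ mu (coins_law pi) _ _ _
  (@transcript _ _ _ _ pi) (fun i => i.2) (fun i => i.1) D)//; last first.
  by move=> [? ?] [? ?] /= -> ->.
have sumE x (F : X * Y -> R) : \sum_(j | j.1 == x) F j = \sum_y F (x, y).
  rewrite (reindex (fun y => (x, y))) /=; last first.
    by exists (fun i => i.2) => // -[? ?]; rewrite inE /= => /eqP->.
  by apply: eq_bigl => y; rewrite eqxx.
apply: eq_bigr => x _; rewrite /chan_info sumE; congr (_ + _).
by apply: eq_bigr => t _; rewrite !sumE.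
Qed.

Lemma info_cost_ge0 mu pi : 0 <= info_cost mu pi.
Proof.
have ln2 : 0 < ln 2 :> R by rewrite ln_gt0// ltr1n.
rewrite -(pmulr_rge0 _ ln2) (info_costE mu (transcripts_uniq pi)); last first.
  exact: mem_transcripts.
by rewrite addr_ge0// sumr_ge0// => i _; apply: chan_info_ge0 => *;
  rewrite ?Defs.pmf_ge0 ?transcript_law_ge0 ?transcript_law_sum1.
Qed.

(** At each node only one party's data matters, and both runs send the same bit there; so the mixed
    run follows the same path. *)
Lemma tree_bits_cut (A B : Type) (s : ptree A B Z) a b a' b' :
  tree_bits s a b = tree_bits s a' b' -> tree_bits s a b' = tree_bits s a b.
Proof.
elim: s => [//|g s0 IH0 s1 IH1|g s0 IH0 s1 IH1] /= [gE].
  by rewrite -gE; case: (g a) => h; congr cons; [apply: IH1 h|apply: IH0 h].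
by rewrite -gE; case: (g b) => h; congr cons; [apply: IH1 h|apply: IH0 h].
Qed.

Lemma tree_output_eq (A B : Type) (s : ptree A B Z) a b a' b' :
  tree_bits s a b = tree_bits s a' b' -> tree_output s a b = tree_output s a' b'.
Proof.
elim: s => [//|g s0 IH0 s1 IH1|g s0 IH0 s1 IH1] /= [gE].
  by rewrite -gE; case: (g a) => h; [apply: IH1 h|apply: IH0 h].
by rewrite -gE; case: (g b) => h; [apply: IH1 h|apply: IH0 h].
Qed.

Lemma transcript_law_gt0P pi i t :
  reflect (exists2 c, 0 < coins_law pi c & transcript i c = t)
          (0 < @transcript_law pi i t).
Proof.
apply: (iffP idP) => [|[c c0 <-]]; last first.
  by apply: lt_le_trans c0 (Pr_ge_pmf _ _); rewrite /= eqxx.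
move=> h; apply: contrapT => nc.
move: h; rewrite /transcript_law /Pr big1 ?ltxx// => c ct.
apply/eqP/negPn/negP => c0; apply: nc; exists c; last exact/eqP.
by rewrite lt_def c0; exact: (Defs.pmf_ge0 (coins_law pi)).
Qed.

(* The rectangle property: the runs of the parties on the two mixed inputs
   are glued into one, using Alice's coins from the first and Bob's from the
   second. *)
Lemma transcript_law_cut pi x y x' y' t :
  0 < @transcript_law pi (x, y') t -> 0 < @transcript_law pi (x', y) t ->
  0 < @transcript_law pi (x, y) t.
Proof.
move=> /transcript_law_gt0P[[u [ra rb]] c0 <-].
move=> /transcript_law_gt0P[[u' [ra' rb']] c'0 [/= uE bE]].
apply/transcript_law_gt0P; exists (u, (ra, rb')).
  have pos (A B : finType) (P : fdist R A) (Q : fdist R B) a b :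
      0 < Defs.fprod P Q (a, b) -> 0 < P a /\ 0 < Q b.
    have := Defs.pmf_ge0 P a; rewrite le_eqVlt /= => /predU1P[<-|Pa].
      by rewrite mul0r ltxx.
    by rewrite pmulr_rgt0.
  have [u0 /pos[a0 _]] := pos _ _ _ _ _ _ c0.
  have [_ /pos[_ b0]] := pos _ _ _ _ _ _ c'0.
  by rewrite /= !mulr_gt0.
rewrite /transcript /=; congr pair.
by move: bE; rewrite uE => bE; apply: tree_bits_cut (esym bE).
Qed.

(** A transcript determines the leaf, hence the output, and under zero error every run of positive
    probability outputs the correct value. *)
Lemma transcript_law_output pi f i j t : performs pi f 0 ->
  0 < @transcript_law pi i t -> 0 < @transcript_law pi j t -> f i = f j.
Proof.
move=> perf.
have out k c : 0 < coins_law pi c -> output k c = f k.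
  move=> c0; apply/eqP/negPn/negP => nE.
  have := le_lt_trans (perf k) c0; rewrite ltNge => /negP; apply.
  exact: (Pr_ge_pmf (coins_law pi) (E := [pred c | output k c != f k])).
move=> /transcript_law_gt0P[c c0 <-] /transcript_law_gt0P[c' c'0 [uE bE]].
rewrite -(out _ _ c0) -(out _ _ c'0) /output; move: bE; rewrite uE => bE.
by rewrite (tree_output_eq bE).
Qed.

End Transcripts.

(** * The protocol in which Alice replaces her input *)

Section ReplacementProtocol.
Variable R : realType.

Fixpoint map_alice (A A' B Z : Type) (g : A' -> A) (s : ptree A B Z) : ptree A' B Z :=
  match s with
  | Output z => Output _ _ z
  | AliceSends q s0 s1 => AliceSends (q \o g) (map_alice g s0) (map_alice g s1)
  | BobSends q s0 s1 => BobSends q (map_alice g s0) (map_alice g s1)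
  end.

Lemma tree_bits_map_alice (A A' B Z : Type) (g : A' -> A) (s : ptree A B Z) a b :
  tree_bits (map_alice g s) a b = tree_bits s (g a) b.
Proof.
by elim: s => [//|q s0 IH0 s1 IH1|q s0 IH0 s1 IH1] /=; case: (q _); congr cons.
Qed.

Lemma tree_output_map_alice (A A' B Z : Type) (g : A' -> A) (s : ptree A B Z) a b :
  tree_output (map_alice g s) a b = tree_output s (g a) b.
Proof. by elim: s => [//|q s0 IH0 s1 IH1|q s0 IH0 s1 IH1] /=; case: (q _). Qed.

Section Bernoulli.
Variables (e : R) (e_ge0 : 0 <= e) (e_le1 : e <= 1).

Lemma bernoulli_ge0 (b : bool) : 0 <= (if b then e else 1 - e).
Proof. by case: b => //; rewrite subr_ge0. Qed.

Lemma bernoulli_sum1 : \sum_(b : bool) (if b then e else 1 - e) = 1.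
Proof. by rewrite big_bool /= subrKC. Qed.

Definition bernoulli_law : fdist R bool := FDist bernoulli_ge0 bernoulli_sum1.

End Bernoulli.

Variables (X Y Z : finType).
Implicit Types (pi : protocol R X Y Z) (f : X * Y -> Z) (mu : fdist R (X * Y)%type).

Section Construction.
Variables (pi : protocol R X Y Z) (x0 x1 : X) (nu : fdist R bool).

Definition replace_input (a : X * (privA pi * bool)) : X * privA pi :=
  (if a.2.2 && (a.1 == x1) then x0 else a.1, a.2.1).

(** The replacement bit joins Alice's private coins, so it stays hidden and the transcripts keep
    their type. *)
Definition replace_protocol : protocol R X Y Z :=
  Protocol (pub_law pi) (Defs.fprod (privA_law pi) nu) (privB_law pi)
    (fun u => map_alice replace_input (ptree_of u)).

Lemma Pr_replace_coins (E : pred (coins replace_protocol)) :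
  Pr (coins_law replace_protocol) E =
  \sum_b nu b * Pr (coins_law pi) [pred c | E (c.1, ((c.2.1, b), c.2.2))].
Proof.
rewrite /Pr; under [RHS]eq_bigr do rewrite mulr_sumr big_mkcond.
rewrite pair_big big_mkcond /=.
rewrite (reindex (fun p : bool * coins pi => (p.2.1, ((p.2.2.1, p.1), p.2.2.2)))) /=.
  by apply: eq_bigr => -[b [u [ra rb]]] _ /=; case: ifP => // _; lra.
exists (fun c => (c.2.1.2, (c.1, (c.2.1.1, c.2.2)))).
  by move=> [b [u [ra rb]]].
by move=> [u [[ra b] rb]].
Qed.

Lemma replace_transcript_law i t :
  @transcript_law _ _ _ _ replace_protocol i t =
  \sum_b nu b * @transcript_law _ _ _ _ pi (if b && (i.1 == x1) then x0 else i.1, i.2) t.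
Proof.
rewrite {1}/transcript_law Pr_replace_coins; apply: eq_bigr => b _.
congr (_ * _); apply: eq_bigl => c /=.
by rewrite /transcript /= tree_bits_map_alice.
Qed.

Lemma replace_error f i :
  Pr (coins_law replace_protocol) [pred c | output i c != f i] =
  \sum_b nu b * Pr (coins_law pi)
    [pred c | output (if b && (i.1 == x1) then x0 else i.1, i.2) c != f i].
Proof.
rewrite Pr_replace_coins; apply: eq_bigr => b _.
congr (_ * _); apply: eq_bigl => c /=.
by rewrite /output /= tree_output_map_alice.
Qed.

Lemma replace_transcript_mem (D : seq (pub pi * seq bool)) :
  (forall i (c : coins pi), transcript i c \in D) ->
  forall i (c : coins replace_protocol), transcript i c \in D.
Proof.
move=> inD [x y] [u [[ra b] rb]]; rewrite /transcript /= tree_bits_map_alice.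
exact: (inD (if b && (x == x1) then x0 else x, y) (u, (ra, rb))).
Qed.

End Construction.

(** Given Bob's input, column [y0] gains and every other column loses at most [e]. Given Alice's
    input, only row [x1] changes, and it loses at most [e * #|Y|] by convexity. *)
Lemma replace_alice_gain mu f pi x0 x1 y0 (e c : R)
    (D : seq (pub pi * seq bool)) (P : pred (pub pi * seq bool)) :
  performs pi f 0 -> uniq D -> (forall i (c : coins pi), transcript i c \in D) ->
  0 < e -> e <= 1 -> 0 < mu (x0, y0) -> 0 < mu (x1, y0) ->
  (forall t, P t -> @transcript_law _ _ _ _ pi (x1, y0) t <=
                    e * @transcript_law _ _ _ _ pi (x0, y0) t) ->
  c <= \sum_(t <- D | P t) @transcript_law _ _ _ _ pi (x0, y0) t ->
  exists2 pi' : protocol R X Y Z, performs pi' f e &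
    ln 2 * info_cost mu pi' <= ln 2 * info_cost mu pi
      - c * mu (x1, y0) * (e * - ln e)
      + (3 - ln (mu (x0, y0)) + 2 * #|{: X * Y}|%:R) * e.
Proof.
move=> perf uD inD e0 e1 mu0 mu1 P1 Pc; have e_ge0 := ltW e0.
pose nu := bernoulli_law e_ge0 e1.
pose pi' := replace_protocol pi x0 x1 nu; exists pi'.
  (* An error requires a replacement, which has probability [e]. *)
  move=> i; rewrite replace_error big_bool /= -[leRHS]addr0 lerD//.
    by rewrite ler_piMr// Pr_le1.
  have -> : (i.1, i.2) = i by case: (i).
  by rewrite mulr_ge0_le0// subr_ge0.
have law'E x y : (@transcript_law _ _ _ _ pi' (x, y) : _ -> R) =
    (fun t => (1 - e) * @transcript_law _ _ _ _ pi (x, y) t +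
    e * @transcript_law _ _ _ _ pi (if x == x1 then x0 else x, y) t).
  by apply/funext => t; rewrite replace_transcript_law big_bool /= addrC.
have colE y : (fun x => @transcript_law _ _ _ _ pi' (x, y)) =
    replace_chan (fun x => @transcript_law _ _ _ _ pi (x, y)) e x0 x1.
  by apply/funext => x; rewrite law'E.
have rowE : (fun y => @transcript_law _ _ _ _ pi' (x1, y)) =
    (fun y t => (1 - e) * @transcript_law _ _ _ _ pi (x1, y) t +
                e * @transcript_law _ _ _ _ pi (x0, y) t).
  by apply/funext => y; rewrite law'E eqxx.
have law0 i t : 0 <= @transcript_law _ _ _ _ pi i t by exact: transcript_law_ge0.
have law1 i : \sum_(t <- D) @transcript_law _ _ _ _ pi i t = 1.
  by apply: law_sum1 => // ?; exact: inD.
have musum : \sum_y \sum_x mu (x, y) = 1.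
  by rewrite exchange_big -[RHS](Defs.pmf_sum1 mu) pair_bigA; apply: eq_bigr => -[].
have mucol y : \sum_x mu (x, y) <= 1.
  rewrite -musum [leRHS](bigD1 y)//= lerDl sumr_ge0// => ? _.
  by rewrite sumr_ge0// => ? _; exact: Defs.pmf_ge0.
have murow x : \sum_y mu (x, y) <= 1.
  rewrite -musum exchange_big [leRHS](bigD1 x)//= lerDl sumr_ge0// => ? _.
  by rewrite sumr_ge0// => ? _; exact: Defs.pmf_ge0.
rewrite (@info_costE _ _ _ _ mu pi' D)//; last exact: replace_transcript_mem.
rewrite (@info_costE _ _ _ _ mu pi D)//.
have cardY : #|Y|%:R <= #|{: X * Y}|%:R :> R.
  rewrite ler_nat card_prod leq_pmull//; apply/card_gt0P; by exists x0.
have cols : \sum_y chan_info D (fun x => mu (x, y)) (fun x => @transcript_law _ _ _ _ pi' (x, y)) <=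
    \sum_y chan_info D (fun x => mu (x, y)) (fun x => @transcript_law _ _ _ _ pi (x, y))
    - c * mu (x1, y0) * (e * - ln e) + (3 - ln (mu (x0, y0)) + #|Y|%:R) * e.
  rewrite (bigD1 y0)//= [in leRHS](bigD1 y0)//=.
  rewrite colE; have := @chan_info_replace_lt R X _ D (fun x => mu (x, y0))
    (fun x => @transcript_law _ _ _ _ pi (x, y0)) e x0 x1.
  move=> /(_ _ _ _ _ e_ge0 e1 c P e0 mu0 mu1 P1 Pc).
  move=> /(_ (fun=> Defs.pmf_ge0 _ _) (mucol _) (fun=> law0 _) (fun=> law1 _)).
  move=> h.
  suff : \sum_(y | y != y0) chan_info D (fun x => mu (x, y)) (fun x => @transcript_law _ _ _ _ pi' (x, y)) <=
      \sum_(y | y != y0) chan_info D (fun x => mu (x, y)) (fun x => @transcript_law _ _ _ _ pi (x, y)) + #|Y|%:R * e.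
    lra.
  apply: (@le_trans _ _ (\sum_(y | y != y0)
     (chan_info D (fun x => mu (x, y)) (fun x => @transcript_law _ _ _ _ pi (x, y)) + e))).
    apply: ler_sum => y _; rewrite colE.
    apply: (@chan_info_replace_le R X _ D _ _ e x0 x1) => // ?; exact: Defs.pmf_ge0.
  rewrite big_split lerD2l sumr_const -[leLHS]mulr_natl ler_wpM2r// ler_nat.
  by rewrite max_card.
suff rows : \sum_x chan_info D (fun y => mu (x, y)) (fun y => @transcript_law _ _ _ _ pi' (x, y)) <=
    \sum_x chan_info D (fun y => mu (x, y)) (fun y => @transcript_law _ _ _ _ pi (x, y))
    + #|Y|%:R * e.
  have := ler_wpM2r e_ge0 cardY; lra.
rewrite (bigD1 x1)//= [in leRHS](bigD1 x1)//=.
rewrite (eq_bigr (fun x => chan_info D (fun y => mu (x, y))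
   (fun y => @transcript_law _ _ _ _ pi (x, y)))) => [|x /negbTE xx1]; last first.
  congr chan_info; apply/funext => y; rewrite law'E xx1.
  by apply/funext => t; lra.
rewrite rowE; have := @chan_info_convex R Y _ D (fun y => mu (x1, y))
  (fun y => @transcript_law _ _ _ _ pi (x1, y)) (fun y => @transcript_law _ _ _ _ pi (x0, y)) e.
move=> /(_ (fun=> Defs.pmf_ge0 _ _) (fun=> law0 _) (fun=> law0 _) e_ge0 e1).
have := @chan_info_le_card R Y _ D (fun y => mu (x1, y))
  (fun y => @transcript_law _ _ _ _ pi (x0, y)).
move=> /(_ (fun=> Defs.pmf_ge0 _ _) (murow _) (fun=> law0 _) (fun=> law1 _)).
move=> /(ler_wpM2l e_ge0).
have := @chan_info_ge0 R Y _ D (fun y => mu (x1, y))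
  (fun y => @transcript_law _ _ _ _ pi (x1, y)).
move=> /(_ (fun=> Defs.pmf_ge0 _ _) (fun=> law0 _) (fun=> law1 _)).
move=> /(mulr_ge0 e_ge0).
lra.
Qed.

End ReplacementProtocol.

(** * Exchanging the roles of Alice and Bob *)

Section Swap.
Variable R : realType.

Fixpoint swap_tree (A B Z : Type) (s : ptree A B Z) : ptree B A Z :=
  match s with
  | Output z => Output _ _ z
  | AliceSends q s0 s1 => BobSends q (swap_tree s0) (swap_tree s1)
  | BobSends q s0 s1 => AliceSends q (swap_tree s0) (swap_tree s1)
  end.

Lemma tree_bits_swap (A B Z : Type) (s : ptree A B Z) a b :
  tree_bits (swap_tree s) b a = tree_bits s a b.
Proof.
by elim: s => [//|q s0 IH0 s1 IH1|q s0 IH0 s1 IH1] /=; case: (q _); congr cons.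
Qed.

Lemma tree_output_swap (A B Z : Type) (s : ptree A B Z) a b :
  tree_output (swap_tree s) b a = tree_output s a b.
Proof. by elim: s => [//|q s0 IH0 s1 IH1|q s0 IH0 s1 IH1] /=; case: (q _). Qed.

Variables (X Y Z : finType).
Implicit Types (pi : protocol R X Y Z) (f : X * Y -> Z) (mu : fdist R (X * Y)%type).

Definition swap_protocol pi : protocol R Y X Z :=
  Protocol (pub_law pi) (privB_law pi) (privA_law pi) (fun u => swap_tree (ptree_of u)).

Lemma swap_law_sum1 mu : \sum_(i : Y * X) mu (i.2, i.1) = 1.
Proof.
rewrite -(Defs.pmf_sum1 mu) [RHS](reindex (fun i : Y * X => (i.2, i.1)))//.
by exists (fun i => (i.2, i.1)) => -[].
Qed.

Definition swap_law mu : fdist R (Y * X)%type :=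
  FDist (fun i => Defs.pmf_ge0 mu (i.2, i.1)) (swap_law_sum1 mu).

Lemma Pr_swap_coins pi (E : pred (coins (swap_protocol pi))) :
  Pr (coins_law (swap_protocol pi)) E =
  Pr (coins_law pi) [pred c | E (c.1, (c.2.2, c.2.1))].
Proof.
rewrite /Pr (reindex (fun c : coins pi => (c.1, (c.2.2, c.2.1)))) /=.
  by apply: eq_bigr => c _; lra.
by exists (fun c => (c.1, (c.2.2, c.2.1))) => -[? []].
Qed.

Lemma swap_transcript_law pi x y t :
  @transcript_law _ _ _ _ (swap_protocol pi) (y, x) t =
  @transcript_law _ _ _ _ pi (x, y) t.
Proof.
rewrite {1}/transcript_law Pr_swap_coins; apply: eq_bigl => c /=.
by rewrite /transcript /= tree_bits_swap.
Qed.

Lemma performs_swap pi f e :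
  performs pi f e -> performs (swap_protocol pi) (fun i => f (i.2, i.1)) e.
Proof.
move=> perf i; rewrite Pr_swap_coins; apply: le_trans (perf (i.2, i.1)).
rewrite le_eqVlt; apply/orP; left; apply/eqP; apply: eq_bigl => c /=.
by rewrite /output /= tree_output_swap.
Qed.

Lemma swap_transcript_mem pi (D : seq (pub pi * seq bool)) :
  (forall i (c : coins pi), transcript i c \in D) ->
  forall i (c : coins (swap_protocol pi)), transcript i c \in D.
Proof.
move=> inD [y x] [u [rb ra]]; rewrite /transcript /= tree_bits_swap.
exact: (inD (x, y) (u, (ra, rb))).
Qed.

(** With [nu] characterized pointwise, the lemma serves both to enter the swapped setting and to
    return from it. *)
Lemma info_cost_swap mu (nu : fdist R (Y * X)%type) pi :
  (forall x y, nu (y, x) = mu (x, y)) ->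
  info_cost nu (swap_protocol pi) = info_cost mu pi.
Proof.
move=> numu.
have ln2 : ln 2 != 0 :> R by rewrite gt_eqF// ln_gt0// ltr1n.
apply: (mulfI ln2).
rewrite (info_costE mu (transcripts_uniq pi) (mem_transcripts (pi := pi))).
rewrite (@info_costE _ _ _ _ nu (swap_protocol pi) (transcripts pi) (transcripts_uniq pi)); last first.
  exact: swap_transcript_mem (mem_transcripts (pi := pi)).
rewrite addrC; congr (_ + _); apply: eq_bigr => i _.
  by congr chan_info; apply/funext => j //; apply/funext => t; rewrite swap_transcript_law.
by congr chan_info; apply/funext => j //; apply/funext => t; rewrite swap_transcript_law.
Qed.

End Swap.

(** * The gain from a replacement by either player *)

Section Gain.
Variables (R : realType) (X Y Z : finType).
Implicit Types (pi : protocol R X Y Z) (f : X * Y -> Z) (mu : fdist R (X * Y)%type).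

Definition adjacent (a b : X * Y) : bool := (a.1 == b.1) || (a.2 == b.2).

Lemma replacement_protocol_gain mu f pi a b (e c : R)
    (P : pred (pub pi * seq bool)) :
  performs pi f 0 -> 0 < e -> e <= 1 -> 0 < mu a -> 0 < mu b -> adjacent a b ->
  (forall t, P t -> @transcript_law _ _ _ _ pi b t <= e * @transcript_law _ _ _ _ pi a t) ->
  c <= \sum_(t <- transcripts pi | P t) transcript_law a t ->
  exists2 pi' : protocol R X Y Z, performs pi' f e &
    ln 2 * info_cost mu pi' <= ln 2 * info_cost mu pi
      - c * mu b * (e * - ln e) + (3 - ln (mu a) + 2 * #|{: X * Y}|%:R) * e.
Proof.
case: a b => [x0 y0] [x1 y1] perf e0 e1 mua mub /orP[/eqP|/eqP] /= E P1 Pc; last first.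
  move: E P1 Pc mub => <- P1 Pc mub.
  have [pi' perf' h] := replace_alice_gain perf (transcripts_uniq pi)
    (mem_transcripts (pi := pi)) e0 e1 mua mub P1 Pc.
  by exists pi'.
move: E P1 Pc mub => <- P1 Pc mub.
(* The inputs share their row, so Bob makes the replacement: he plays Alice in the swapped
   protocol. *)
have := @replace_alice_gain R Y X Z (swap_law mu) (fun i => f (i.2, i.1))
  (swap_protocol pi) y0 y1 x0 e c (transcripts pi) P (performs_swap perf)
  (transcripts_uniq pi) (swap_transcript_mem (mem_transcripts (pi := pi))) e0 e1 mua mub.
case=> [t Pt||pi' perf' h].
- by rewrite !swap_transcript_law; exact: P1.
- by apply: le_trans Pc _; under [leRHS]eq_bigr do rewrite swap_transcript_law.
exists (swap_protocol pi').
  have -> : f = (fun i => (fun i => f (i.2, i.1)) (i.2, i.1)) by apply/funext => -[].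
  exact: performs_swap perf'.
rewrite (@info_cost_swap _ _ _ _ (swap_law mu) mu pi')//.
move: h; rewrite (@info_cost_swap _ _ _ _ mu (swap_law mu) pi)//=.
by rewrite !card_prod mulnC.
Qed.

End Gain.

(** * From near-optimal protocols to bounds on the information complexity *)

Section InformationComplexity.
Variables (R : realType) (X Y Z : finType).
Variables (f : X * Y -> Z) (mu : fdist R (X * Y)%type).
Implicit Types (pi : protocol R X Y Z) (a b i j : X * Y) (c e m tau : R).

Lemma IC_le pi e : performs pi f e -> IC mu f e <= info_cost mu pi.
Proof.
move=> perf; apply: ge_inf; last by exists pi.
by exists 0 => _ [pi' _ ->]; exact: info_cost_ge0.
Qed.

Lemma IC_near (gamma : R) : 0 < IC mu f 0 -> 0 < gamma ->
  exists2 pi, performs pi f 0 & info_cost mu pi <= IC mu f 0 + gamma.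
Proof.
move=> IC0 g0.
have [|_ [pi perf ->] /ltW le] := @inf_adherent R
  [set c : R | exists2 pi, performs pi f 0 & c = info_cost mu pi]%classic gamma g0.
  split; last by exists 0 => _ [pi' _ ->]; exact: info_cost_ge0.
  (* The infimum of the empty set is 0 by default, so [IC0] guarantees that a zero-error protocol
     exists. *)
  apply/set0P/eqP => E0; move: IC0; rewrite /IC E0 inf0 ltxx//.
by exists pi.
Qed.

Lemma binary_entropyE e : ln 2 * binary_entropy e = - xlnx e - xlnx (1 - e).
Proof.
have ln2 : ln 2 != 0 :> R by rewrite gt_eqF// ln_gt0// ltr1n.
have simp (p q : R) : ln 2 * (p * (q / ln 2)) = p * q.
  by rewrite mulrCA (mulrC (ln 2)) mulfVK.
by rewrite /binary_entropy /log2 mulrBr mulrN !simp.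
Qed.

Lemma binary_entropy_le e : 0 <= e -> e <= 1 ->
  ln 2 * binary_entropy e <= e * - ln e + e.
Proof.
move=> e0 e1; rewrite binary_entropyE.
have := @xlnx_ge_subr1 _ (1 - e); rewrite subr_ge0 => /(_ e1).
rewrite [xlnx e]/xlnx; lra.
Qed.

(* Chosen so that [c * m * - ln e] dominates twice the coefficient of the O(e) loss. *)
Definition error_threshold c m (n : nat) : R :=
  expR (- (2 * (4 + m^-1 + 2 * n%:R) / (c * m))).

(** Half of the gain [c * mu b * (e * - ln e)] pays for [tau * binary_entropy e], the other half for
    the terms of order [e]; then [gamma] tends to 0. The protocol, the inputs and [P] may depend on
    [gamma]. *)
Lemma IC_gain c m tau e : 0 < IC mu f 0 -> 0 < c -> c <= 1 -> 0 < m ->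
  0 < e -> e <= error_threshold c m #|{: X * Y}| ->
  (forall gamma : R, 0 < gamma -> exists pi a b, exists P : pred (pub pi * seq bool),
    [/\ performs pi f 0, info_cost mu pi <= IC mu f 0 + gamma,
        [/\ m <= mu a, m <= mu b, tau <= c * mu b / 2 & adjacent a b],
        forall t, P t -> transcript_law b t <= e * transcript_law a t &
        c <= \sum_(t <- transcripts pi | P t) transcript_law a t]) ->
  IC mu f e <= IC mu f 0 - tau * binary_entropy e.
Proof.
move=> IC0 c0 c1 m0 e0 eT near.
have ln2 : 0 < ln 2 :> R by rewrite ln_gt0// ltr1n.
set K := 3 + m^-1 + 2 * #|{: X * Y}|%:R : R.
have K0 : 0 < K.
  by rewrite ltr_wpDr ?mulr_ge0// ltr_wpDr// invr_ge0 ltW.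
have eL : 2 * (K + 1) / (c * m) <= - ln e.
  rewrite lerNr -[leRHS]expRK ler_ln ?posrE ?expR_gt0//.
  apply: le_trans eT _; rewrite /error_threshold /K ler_expR lerN2.
  by rewrite ler_pM2r ?invr_gt0 ?mulr_gt0//; lra.
have e1 : e <= 1.
  apply: le_trans eT _; rewrite /error_threshold -[leRHS]expR0 ler_expR oppr_le0.
  rewrite divr_ge0 ?mulr_ge0 ?(ltW c0) ?(ltW m0)//.
  by move: K0; rewrite /K; lra.
apply/ler_addgt0Pr => gamma gamma0.
have [pi [a [b [P [perf cost [ma mb taub ab] Pe Pc]]]]] := near _ gamma0.
have mua := lt_le_trans m0 ma; have mub := lt_le_trans m0 mb.
have [pi' perf' cost'] := replacement_protocol_gain perf e0 e1 mua mub ab Pe Pc.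
rewrite -(ler_pM2l ln2); apply: le_trans (ler_wpM2l (ltW ln2) (IC_le perf')) _.
apply: le_trans cost' _.
have := ler_wpM2l (ltW ln2) cost.
(* This bounds the loss in terms of [m] alone, as the threshold requires. *)
have lna : - ln (mu a) <= m^-1.
  rewrite -lnV ?posrE//; apply: le_trans (ln_le_subr1 _) _; rewrite ?invr_gt0//.
  have : (mu a)^-1 <= m^-1 by rewrite lef_pV2 ?posrE.
  lra.
have := ler_wpM2r (ltW e0) lna.
have cm : 2 * (K + 1) <= c * m * - ln e.
  by move: eL; rewrite ler_pdivrMr ?mulr_gt0// [_ * (c * m)]mulrC.
have L0 : 0 <= - ln e.
  by apply: le_trans eL; rewrite divr_ge0 ?(ltW (mulr_gt0 c0 m0))//; lra.
have mub1 : mu b <= 1 by exact: pmf_le1.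
have cb1 : c * mu b <= 1 by rewrite mulr_ile1// ltW.
have eLe0 : 0 <= e * - ln e by rewrite mulr_ge0// ltW.
(* For negative [tau] it is enough that the gain covers the terms of order [e]. *)
have [tau0|tau0] := leP 0 tau; last first.
  have hneg : tau * binary_entropy e <= 0.
    rewrite nmulr_rle0// -(pmulr_rge0 _ ln2).
    rewrite binary_entropyE -opprD oppr_ge0 -[leRHS]addr0 lerD// xlnx_le0//; lra.
  have := ler_wpM2l (ltW ln2) hneg.
  have h1 : c * m * - ln e <= c * mu b * - ln e by rewrite ler_wpM2r// ler_wpM2l// ltW.
  have h2 : K <= c * mu b * - ln e by lra.
  have := ler_wpM2l (ltW e0) h2.
  rewrite /K; lra.
have ent := ler_wpM2l tau0 (binary_entropy_le (ltW e0) e1).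
have h1 : 2 * tau * - ln e <= c * mu b * - ln e by rewrite ler_wpM2r//; lra.
have h2 : c * m * - ln e <= c * mu b * - ln e by rewrite ler_wpM2r// ler_wpM2l// ltW.
have h3 : tau * - ln e + tau + K <= c * mu b * - ln e by lra.
have := ler_wpM2l (ltW e0) h3.
move: ent; rewrite /K; lra.
Qed.

Lemma binary_entropy0 : binary_entropy 0 = 0 :> R.
Proof. by rewrite /binary_entropy /log2 subr0 ln1 !mul0r mulr0 oppr0 addr0. Qed.

Lemma transcript_law_cover pi i (P Q : pred (pub pi * seq bool)) :
  (forall t, 0 < transcript_law i t -> P t || Q t) ->
  2^-1 <= \sum_(t <- transcripts pi | P t) transcript_law i t \/
  2^-1 <= \sum_(t <- transcripts pi | Q t) transcript_law i t.
Proof.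
move=> PQ; apply/orP; apply/negPn/negP; rewrite negb_or -!ltNge => /andP[hP hQ].
suff : 1 <= \sum_(t <- transcripts pi | P t) transcript_law i t +
           \sum_(t <- transcripts pi | Q t) transcript_law i t by lra.
rewrite -(transcript_law_sum1 pi i) [X in _ <= X + _]big_mkcond [X in _ <= _ + X]big_mkcond.
rewrite -big_split ler_sum// => t _ /=.
have := transcript_law_ge0 i t; rewrite le_eqVlt => /predU1P[<-|it].
  by rewrite !if_same addr0.
by have /orP[->|->] := PQ t it; rewrite ?lerDl ?lerDr; case: ifP => // _; rewrite ltW.
Qed.

Lemma law_eq0 pi i t : ~ 0 < @transcript_law _ _ _ _ pi i t ->
  @transcript_law _ _ _ _ pi i t = 0.
Proof.
by move=> /negP; rewrite -leNgt => h; apply/eqP; rewrite eq_le h transcript_law_ge0.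
Qed.

Lemma IC_gain_nonconstant a b tau e : 0 < IC mu f 0 -> 0 < mu a -> 0 < mu b ->
  adjacent a b -> f a <> f b -> tau <= mu b / 4 ->
  0 <= e <= error_threshold 2^-1 (Num.min (mu a) (mu b)) #|{: X * Y}| ->
  IC mu f e <= IC mu f 0 - tau * binary_entropy e.
Proof.
(* At [e = 0] the entropy vanishes and the claim is trivial; the replacement argument requires
   [e > 0]. *)
move=> IC0 mua mub ab fab taub /andP[]; rewrite le_eqVlt => /predU1P[<- _|e0 eT].
  by rewrite binary_entropy0 mulr0 subr0.
apply: (@IC_gain 2^-1 (Num.min (mu a) (mu b))) => //; first by lra.
  by rewrite lt_min mua mub.
move=> gamma gamma0; have [pi perf cost] := IC_near IC0 gamma0.
exists pi, a, b, (fun t => transcript_law b t == 0); split=> //.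
- by split=> //; rewrite ?ge_min ?lexx ?orbT//; lra.
- by move=> t /eqP ->; rewrite mulr_ge0 ?transcript_law_ge0// ltW.
(* Every transcript possible at [a] is impossible at [b]. Using the covering lemma with the same
   predicate twice gives the bound 1/2, which is enough here. *)
- suff: forall t, 0 < transcript_law a t ->
      (@transcript_law _ _ _ _ pi b t == 0) || (@transcript_law _ _ _ _ pi b t == 0).
    by case/transcript_law_cover.
  move=> t at0; rewrite orbb; apply/eqP/law_eq0 => bt0; apply: fab.
  exact: transcript_law_output perf at0 bt0.
Qed.

Lemma IC_gain_and x0 x1 y0 y1 tau e : 0 < IC mu f 0 ->
  f (x0, y1) = f (x0, y0) -> f (x1, y0) = f (x0, y0) -> f (x1, y1) <> f (x0, y0) ->
  0 < mu (x0, y0) -> 0 < mu (x0, y1) -> 0 < mu (x1, y0) ->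
  tau <= mu (x0, y1) / 4 -> tau <= mu (x1, y0) / 4 ->
  0 <= e <= error_threshold 2^-1
    (Num.min (mu (x0, y0)) (Num.min (mu (x0, y1)) (mu (x1, y0)))) #|{: X * Y}| ->
  IC mu f e <= IC mu f 0 - tau * binary_entropy e.
Proof.
move=> IC0 f01 f10 f11 m00 m01 m10 tau01 tau10 /andP[].
rewrite le_eqVlt => /predU1P[<- _|e0 eT]; first by rewrite binary_entropy0 mulr0 subr0.
apply: (@IC_gain 2^-1 _ _ _ IC0 _ _ _ e0 eT) => //; first by lra.
  by rewrite !lt_min m00 m01 m10.
move=> gamma gamma0; have [pi perf cost] := IC_near IC0 gamma0.
have [] : 2^-1 <= \sum_(t <- transcripts pi | transcript_law (x0, y1) t == 0)
                    transcript_law (x0, y0) t \/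
       2^-1 <= \sum_(t <- transcripts pi | transcript_law (x1, y0) t == 0)
                    transcript_law (x0, y0) t.
(* A transcript possible at both [(x0, y1)] and [(x1, y0)] is possible at [(x1, y1)], where the
   zero-error protocol must output another value. *)
- apply: transcript_law_cover => t t00; apply/orP.
  have [_|t01] := eqVneq (transcript_law (x0, y1) t) 0; [by left|right].
  apply/eqP/law_eq0 => t10; apply: f11.
  have {}t01 : 0 < transcript_law (x0, y1) t by rewrite lt_def t01 transcript_law_ge0.
  exact: transcript_law_output perf (transcript_law_cut t10 t01) t00.
- move=> h; exists pi, (x0, y0), (x0, y1), (fun t => transcript_law (x0, y1) t == 0).
  split=> // [|t /eqP->]; last by rewrite mulr_ge0 ?transcript_law_ge0// ltW.
  by split; rewrite ?ge_min ?lexx ?orbT// /adjacent ?eqxx//; lra.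
- move=> h; exists pi, (x0, y0), (x1, y0), (fun t => transcript_law (x1, y0) t == 0).
  split=> // [|t /eqP->]; last by rewrite mulr_ge0 ?transcript_law_ge0// ltW.
  by split; rewrite ?ge_min ?lexx ?orbT// /adjacent ?eqxx ?orbT//; lra.
Qed.

Definition supp_adjacent : rel (X * Y) :=
  [rel a b | [&& 0 < mu a, 0 < mu b & adjacent a b]].

(* A near-optimal protocol distinguishes two adjacent inputs on the way from i to j,
   for otherwise some transcript would be likely at every input on the way,
   hence possible at i, j and, by the rectangle property, at (i.1, j.2). The
   constant c does not depend on the protocol nor on eta. *)
Lemma distinguishing_step i j : 0 < IC mu f 0 -> connect supp_adjacent i j ->
  (f (i.1, j.2) <> f i \/ f (i.1, j.2) <> f j) ->
  exists c : R, [/\ 0 < c, c <= 1 & forall eta gamma : R, 0 < eta -> 0 < gamma ->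
    exists pi a b, [/\ performs pi f 0, info_cost mu pi <= IC mu f 0 + gamma,
      supp_adjacent a b &
      c <= \sum_(t <- transcripts pi | transcript_law b t <= eta * transcript_law a t)
             transcript_law a t]].
Proof.
move=> IC0 ij fij; apply: contrapT => nc.
have H c : 0 < c -> c <= 1 -> exists eta gamma, [/\ 0 < eta, 0 < gamma &
    forall pi a b, performs pi f 0 -> info_cost mu pi <= IC mu f 0 + gamma ->
      supp_adjacent a b ->
      \sum_(t <- transcripts pi | transcript_law b t <= eta * transcript_law a t)
        transcript_law a t < c].
  move=> c0 c1; apply: contrapT => nH; apply: nc; exists c; split=> // eta gamma eta0 gamma0.
  apply: contrapT => npi; apply: nH; exists eta, gamma; split=> // pi a b perf cost ab.
  by rewrite ltNge; apply/negP => h; apply: npi; exists pi, a, b.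
(* By induction along the path, transcripts possible at [i] keep a mass at [j] bounded below
   uniformly over near-optimal protocols. *)
have [d [gamma [d0 gamma0 likely]]] : exists d gamma, [/\ 0 < d, 0 < gamma &
    forall pi, performs pi f 0 -> info_cost mu pi <= IC mu f 0 + gamma ->
      d <= \sum_(t <- transcripts pi | 0 < transcript_law i t) transcript_law j t].
  have /connectP[p ip ->] := ij; elim/last_ind: p ip => [_|p b IH].
    exists 1, 1; split=> // pi _ _; rewrite -(transcript_law_sum1 pi i) /=.
    rewrite [leRHS]big_mkcond ler_sum// => t _.
    by case: ltP => // ?.
  rewrite rcons_path last_rcons => /andP[/IH[d [g1 [d0 g10 h1]]]].
  set a := last i p in h1 * => ab.
  have m1 : Num.min d 1 <= 1 by rewrite ge_min lexx orbT.
  have md : Num.min d 1 <= d by rewrite ge_min lexx.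
  have m0 : 0 < Num.min d 1 by rewrite lt_min d0 ltr01.
  (* Transcripts at most [eta] times as likely at [b] have mass at most [d / 2] at [a]; the rest of
     the mass [d], at least [d / 2], shrinks by a factor no worse than [eta]. *)
  have [||eta [g2 [eta0 g20 h2]]] := H (Num.min d 1 / 2); [by lra..|].
  exists (eta * (d / 2)), (Num.min g1 g2); split.
  - by rewrite mulr_gt0// divr_gt0.
  - by rewrite lt_min g10 g20.
  move=> pi perf cost.
  have {}h1 : d <= _ := h1 pi perf (le_trans cost _).
  have {}h2 := h2 pi a b perf (le_trans cost _) ab.
  have g1le : IC mu f 0 + Num.min g1 g2 <= IC mu f 0 + g1 by rewrite lerD2l ge_min lexx.
  have g2le : IC mu f 0 + Num.min g1 g2 <= IC mu f 0 + g2.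
    by rewrite lerD2l ge_min lexx orbT.
  move: h1 h2 => /(_ g1le) h1 /(_ g2le) h2.
  apply: (@le_trans _ _ (eta * (\sum_(t <- transcripts pi | 0 < transcript_law i t)
      transcript_law a t - \sum_(t <- transcripts pi |
      transcript_law b t <= eta * transcript_law a t) transcript_law a t))).
    by rewrite ler_wpM2l ?(ltW eta0)//; lra.
  rewrite [X in X - _]big_mkcond [X in _ - X]big_mkcond -sumrB mulr_sumr.
  rewrite [leRHS]big_mkcond ler_sum// => t _.
  have at0 := transcript_law_ge0 a t; have bt0 := transcript_law_ge0 b t.
  have eat0 : 0 <= eta * transcript_law a t by rewrite mulr_ge0// ltW.
  case: ifP => _; case: ifPn => h; rewrite ?subrr ?sub0r ?subr0 ?mulr0 ?mulrN ?oppr_le0//.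
  by rewrite ltW// ltNge.
have [pi perf cost] := IC_near IC0 gamma0.
have := lt_le_trans d0 (likely pi perf cost); apply/negP; rewrite -leNgt.
rewrite big1// => t it; apply: law_eq0 => jt.
have ijt : 0 < @transcript_law _ _ _ _ pi (i.1, j.2) t.
  by apply: (@transcript_law_cut _ _ _ _ pi _ _ j.1 i.2); rewrite -surjective_pairing.
by case: fij; apply; apply: transcript_law_output perf ijt _.
Qed.

Lemma supp_lower_bound : exists2 m : R, 0 < m & forall i, 0 < mu i -> m <= mu i.
Proof.
exists (\big[Num.min/1]_(i | 0 < mu i) mu i).
  by elim/big_ind: _ => // x y x0 y0; rewrite lt_min x0 y0.
by move=> i mui; rewrite (bigD1 i)//= ge_min lexx.
Qed.

Lemma IC_gain_connected i j : 0 < IC mu f 0 -> connect supp_adjacent i j ->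
  (f (i.1, j.2) <> f i \/ f (i.1, j.2) <> f j) ->
  exists tau eps0 : R, [/\ 0 < tau, 0 < eps0 & forall e, 0 <= e <= eps0 ->
    IC mu f e <= IC mu f 0 - tau * binary_entropy e].
Proof.
move=> IC0 ij fij; have [c [c0 c1 step]] := distinguishing_step IC0 ij fij.
have [m m0 mle] := supp_lower_bound.
exists (c * m / 2), (error_threshold c m #|{: X * Y}|); split.
- by rewrite divr_gt0// mulr_gt0.
- exact: expR_gt0.
move=> e /andP[]; rewrite le_eqVlt => /predU1P[<- _|e0 eT].
  by rewrite binary_entropy0 mulr0 subr0.
apply: (@IC_gain c m) => // gamma gamma0.
(* The ratio [eta] is taken to be [e]; since [c] was fixed first, [tau] and the threshold do not
   depend on it. *)
have [pi [a [b [perf cost /and3P[mua mub ab] h]]]] := step e gamma e0 gamma0.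
exists pi, a, b, (fun t => transcript_law b t <= e * transcript_law a t).
split=> //; split; rewrite ?mle//.
by rewrite ler_wpM2r// ler_wpM2l ?mle// ltW.
Qed.

End InformationComplexity.

(** * A zero-cost protocol when the function is constant along components *)

Section ComponentProtocol.
Variables (R : realType) (X Y Z : finType).
Variables (f : X * Y -> Z) (mu : fdist R (X * Y)%type).
Hypothesis f_rect : forall i j, connect (supp_adjacent mu) i j ->
  f (i.1, j.2) = f i /\ f (i.1, j.2) = f j.

(* Alice sends the value of g, as its position in the list s. *)
Fixpoint send_value (L : eqType) (A B : Type) (g : A -> L) (s : seq L)
    (d : ptree A B Z) (k : L -> ptree A B Z) : ptree A B Z :=
  match s with
  | [::] => d
  | l :: s' => AliceSends (fun a => g a == l) (send_value g s' d k) (k l)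
  end.

Lemma tree_bits_send_value (L : eqType) (A B : Type) (g : A -> L) s d k a (b : B) :
  g a \in s -> tree_bits (send_value g s d k) a b =
  rcons (nseq (index (g a) s) false) true ++ tree_bits (k (g a)) a b.
Proof.
elim: s => [//|l s IH]; rewrite inE /= [l == _]eq_sym; case: eqP => [->//|_] /=.
by move=> /IH ->.
Qed.

Lemma tree_output_send_value (L : eqType) (A B : Type) (g : A -> L) s d k a (b : B) :
  g a \in s -> tree_output (send_value g s d k) a b = tree_output (k (g a)) a b.
Proof.
by elim: s => [//|l s IH]; rewrite inE /=; case: eqP => [->//|_]; exact: IH.
Qed.

(** Bob's announcement is Alice's with the roles exchanged, and the inner [swap_tree] restores the
    roles for the rest of the tree. The label [z] belongs to leaves that are never reached. *)
Definition send_both (LA LB : finType) (A B : Type) (g : A -> LA) (h : B -> LB)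
    (z : Z) (k : LA -> LB -> ptree A B Z) : ptree A B Z :=
  send_value g (enum LA) (Output _ _ z) (fun l =>
    swap_tree (send_value h (enum LB) (Output _ _ z) (fun l' => swap_tree (k l l')))).

Lemma tree_bits_send_both (LA LB : finType) (A B : Type) (g : A -> LA) (h : B -> LB)
    z k a b :
  tree_bits (send_both g h z k) a b =
  (rcons (nseq (index (g a) (enum LA)) false) true ++
   rcons (nseq (index (h b) (enum LB)) false) true) ++ tree_bits (k (g a) (h b)) a b.
Proof.
rewrite tree_bits_send_value ?mem_enum// tree_bits_swap.
by rewrite tree_bits_send_value ?mem_enum// tree_bits_swap catA.
Qed.

Lemma tree_output_send_both (LA LB : finType) (A B : Type) (g : A -> LA) (h : B -> LB)
    z k a b :
  tree_output (send_both g h z k) a b = tree_output (k (g a) (h b)) a b.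
Proof.
rewrite tree_output_send_value ?mem_enum// tree_output_swap.
by rewrite tree_output_send_value ?mem_enum// tree_output_swap.
Qed.

(** The root represents the component of the support that meets the row. Support points of one row
    are adjacent, so the choice made by [pick] is immaterial. *)
Definition component_row (x : X) : option (X * Y) :=
  if [pick i | (0 < mu i) && (i.1 == x)] is Some i
  then Some (fingraph.root (supp_adjacent mu) i) else None.

Definition component_col (y : Y) : option (X * Y) :=
  if [pick i | (0 < mu i) && (i.2 == y)] is Some i
  then Some (fingraph.root (supp_adjacent mu) i) else None.

Lemma supp_connect_sym : connect_sym (supp_adjacent mu).
Proof.
apply: sym_connect_sym => i j; rewrite /supp_adjacent /= andbCA; congr [&& _, _ & _].
by rewrite /adjacent eq_sym [in LHS](eq_sym i.2).
Qed.

Lemma component_rowE i : 0 < mu i ->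
  component_row i.1 = Some (fingraph.root (supp_adjacent mu) i).
Proof.
move=> mui; rewrite /component_row; case: pickP => [j /andP[muj ji]|/(_ i)]; last first.
  by rewrite mui eqxx.
congr Some; apply/(fingraph.rootP supp_connect_sym)/connect1.
by rewrite /supp_adjacent /= muj mui /adjacent ji.
Qed.

Lemma component_colE i : 0 < mu i ->
  component_col i.2 = Some (fingraph.root (supp_adjacent mu) i).
Proof.
move=> mui; rewrite /component_col; case: pickP => [j /andP[muj ji]|/(_ i)]; last first.
  by rewrite mui eqxx.
congr Some; apply/(fingraph.rootP supp_connect_sym)/connect1.
by rewrite /supp_adjacent /= muj mui /adjacent ji orbT.
Qed.

Lemma unit_law_ge0 (u : unit) : 0 <= 1 :> R. Proof. exact: ler01. Qed.

Lemma unit_law_sum1 : \sum_(u : unit) 1 = 1 :> R.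
Proof. by rewrite sumr_const card_unit. Qed.

Definition unit_law : fdist R unit := FDist unit_law_ge0 unit_law_sum1.

(** Inputs outside the support may have missing or distinct components; there both inputs are
    revealed, at no cost because such inputs have mass 0. *)
Definition component_tree (z : Z) : ptree (X * unit) (Y * unit) Z :=
  send_both (fun a => component_row a.1) (fun b => component_col b.1) z (fun l l' =>
    if (l, l') is (Some r, Some r') then
      if r == r' then Output _ _ (f r)
      else send_both (fun a => a.1) (fun b => b.1) z (fun x y => Output _ _ (f (x, y)))
    else send_both (fun a => a.1) (fun b => b.1) z (fun x y => Output _ _ (f (x, y)))).

Definition component_protocol (z : Z) : protocol R X Y Z :=
  Protocol unit_law unit_law unit_law (fun=> component_tree z).

(** If the components agree, [f_rect] equates the value at [(a.1, b.1)] with that at [i], and then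
    with that at the root. *)
Lemma component_output z a b : tree_output (component_tree z) a b = f (a.1, b.1).
Proof.
rewrite tree_output_send_both.
rewrite /component_row; case: pickP => [i /andP[mui /eqP ia]|_]; last first.
  exact: tree_output_send_both.
rewrite /component_col; case: pickP => [j /andP[muj /eqP jb]|_]; last first.
  exact: tree_output_send_both.
case: eqP => [/(fingraph.rootP supp_connect_sym) ij|_]; last exact: tree_output_send_both.
have [h1 _] := f_rect ij; rewrite -ia -jb h1 /=.
have [h2 h3] := f_rect (connect_root (supp_adjacent mu) i).
by rewrite -h2 h3.
Qed.

Lemma component_bits z i j u : 0 < mu i -> 0 < mu j ->
  adjacent i j ->
  tree_bits (component_tree z) (i.1, u.1) (i.2, u.2) =
  tree_bits (component_tree z) (j.1, u.1) (j.2, u.2).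
Proof.
move=> mui muj ij; rewrite !tree_bits_send_both /=.
rewrite !component_rowE// !component_colE// eqxx eqxx.
by have /(fingraph.rootP supp_connect_sym) -> : connect (supp_adjacent mu) i j
  by apply: connect1; rewrite /supp_adjacent /= mui muj.
Qed.

(** Support inputs sharing a coordinate are adjacent, so they have the same component and the same
    transcript: given either input, nothing is revealed about the other. *)
Lemma IC_eq0_of_rect : IC mu f 0 <= 0.
Proof.
have [i0 _] : exists i : X * Y, true.
  apply: contrapT => ni; have := Defs.pmf_sum1 mu; rewrite big1 => [/esym/eqP|i _].
    by rewrite oner_eq0.
  by case: ni; exists i.
have perf : performs (component_protocol (f i0)) f 0.
  move=> i; rewrite /Pr big_pred0// => c /=.
  by rewrite /output /= component_output -surjective_pairing eqxx.
apply: le_trans (IC_le mu perf) _.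
have ln2 : 0 < ln 2 :> R by rewrite ln_gt0// ltr1n.
rewrite -(pmulr_rle0 _ ln2).
rewrite (info_costE mu (transcripts_uniq _) (mem_transcripts (pi := _))).
have law_eq i j t : 0 < mu i -> 0 < mu j -> adjacent i j ->
    @transcript_law _ _ _ _ (component_protocol (f i0)) i t = transcript_law j t.
  move=> mui muj ij; apply: eq_bigl => -[u u'] /=.
  by rewrite /transcript /= (component_bits _ _ mui muj ij).
rewrite !big1 ?addr0// => k _; apply: chan_info_eq0 => [?|? ?|?|? ? ? ? ?];
  rewrite ?Defs.pmf_ge0 ?transcript_law_ge0 ?transcript_law_sum1//;
  by apply: law_eq; rewrite // /adjacent eqxx ?orbT.
Qed.

End ComponentProtocol.

Theorem mainTheorem1 (R : realType) :
  (forall (X Y Z : finType) (f : X * Y -> Z) (mu : fdist R (X * Y)%type),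
     0 < IC mu f 0 ->
     exists tau eps0 : R, [/\ 0 < tau, 0 < eps0 &
       forall eps : R, 0 <= eps <= eps0 ->
         IC mu f eps <= IC mu f 0 - tau * binary_entropy eps])
  /\
  (exists eps0 : R -> nat -> R,
     (forall (m : R) (n : nat), 0 < m -> 0 < eps0 m n) /\
     forall (X Y Z : finType) (f : X * Y -> Z) (mu : fdist R (X * Y)%type),
       0 < IC mu f 0 ->
       forall a b : X * Y,
         0 < mu a -> 0 < mu b ->
         (a.1 = b.1 \/ a.2 = b.2) ->
         f a <> f b ->
         exists tau : R, mu a ^+ 2 * mu b / 64 <= tau /\
           forall eps : R,
             0 <= eps <= eps0 (Num.min (mu a) (mu b)) #|{: X * Y}| ->
             IC mu f eps <= IC mu f 0 - tau * binary_entropy eps)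
  /\
  (exists eps0 : R -> nat -> R,
     (forall (m : R) (n : nat), 0 < m -> 0 < eps0 m n) /\
     forall (X Y Z : finType) (f : X * Y -> Z) (mu : fdist R (X * Y)%type),
       0 < IC mu f 0 ->
       forall (x0 x1 : X) (y0 y1 : Y) (z0 z1 : Z),
         f (x0, y0) = z0 -> f (x0, y1) = z0 -> f (x1, y0) = z0 ->
         f (x1, y1) = z1 -> z1 <> z0 ->
         0 < mu (x0, y0) -> 0 < mu (x0, y1) -> 0 < mu (x1, y0) ->
         exists tau : R,
           mu (x0, y0) ^+ 2 / 128 * Num.min (mu (x0, y1)) (mu (x1, y0)) <= tau /\
           forall eps : R,
             0 <= eps <= eps0 (Num.min (mu (x0, y0))
                                       (Num.min (mu (x0, y1)) (mu (x1, y0))))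
                              #|{: X * Y}| ->
             IC mu f eps <= IC mu f 0 - tau * binary_entropy eps).
Proof.
split; last split.
- move=> X Y Z f mu IC0.
  have [i [j [ij fij]]] : exists i j, connect (supp_adjacent mu) i j /\
      (f (i.1, j.2) <> f i \/ f (i.1, j.2) <> f j).
    (* If no such pair existed, the component protocol would have cost 0. *)
    apply: contrapT => nij; move: IC0; apply/negP; rewrite -leNgt.
    apply: IC_eq0_of_rect => i j ij.
    by split; apply: contrapT => fij; apply: nij; exists i, j; split=> //; [left|right].
  exact: IC_gain_connected IC0 ij fij.
- exists (fun m n => error_threshold 2^-1 m n); split=> [m n _|]; first exact: expR_gt0.
  move=> X Y Z f mu IC0 a b mua mub ab fab.
  (* As [mu a <= 1], this is at most the constant [mu b / 4] which the argument allows. *)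
  exists (mu a ^+ 2 * mu b / 64); split=> // eps.
  apply: IC_gain_nonconstant => //.
    by rewrite /adjacent; case: ab => ->; rewrite eqxx ?orbT.
  have a1 : mu a ^+ 2 <= 1 by rewrite expr_le1// ?(ltW mua) ?pmf_le1.
  have := ler_wpM2r (ltW mub) a1; lra.
- exists (fun m n => error_threshold 2^-1 m n); split=> [m n _|]; first exact: expR_gt0.
  move=> X Y Z f mu IC0 x0 x1 y0 y1 z0 z1 f00 f01 f10 f11 z10 m00 m01 m10.
  exists (mu (x0, y0) ^+ 2 / 128 * Num.min (mu (x0, y1)) (mu (x1, y0))); split=> // eps.
  have a1 : mu (x0, y0) ^+ 2 <= 1 by rewrite expr_le1// ?(ltW m00) ?pmf_le1.
  have min0 : 0 <= Num.min (mu (x0, y1)) (mu (x1, y0)) by rewrite le_min !ltW.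
  have h := ler_wpM2r min0 a1.
  have hl : Num.min (mu (x0, y1)) (mu (x1, y0)) <= mu (x0, y1) by rewrite ge_min lexx.
  have hr : Num.min (mu (x0, y1)) (mu (x1, y0)) <= mu (x1, y0).
    by rewrite ge_min lexx orbT.
  by apply: IC_gain_and; rewrite ?f00 ?f11 ?f10 ?f01//; lra.
Qed.
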